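(* Fix $k\in\mathbb{N}$. There is an algorithm which, given a connected graph $G$ with vertex set $\{1,\ldots,n\}$ as an adjacency list, decides whether $l(G)\le k$, and runs in $O(n)$ time (the implied constant may depend on $k$).
   Context: For $a\neq b$ in $\{1,\ldots,n\}$, $(a\to b)$ denotes the transformation of $\{1,\ldots,n\}$ mapping $a$ to $b$ and fixing every other point. Transformations act on the right and are composed left to right: $v(\alpha\beta)=(v\alpha)\beta$. A digraph $D$ on $\{1,\ldots,n\}$ (no loops, no multiple arcs) determines the semigroup $\langle D\rangle$ generated by the transformations $(a\to b)$ for all arcs $(a,b)$ of $D$. A graph is a digraph in which $(u,v)$ is an arc iff $(v,u)$ is an arc. A cycle of length $k$ of a transformation $\alpha$ is a sequence of distinct points $a_0,\ldots,a_{k-1}$ with $a_i\alpha=a_{i+1}$ (indices mod $k$); $l(\alpha)$ is the length of a longest cycle of $\alpha$, and $l(D)=\max\{l(\alpha):\alpha\in\langle D\rangle\}$. *)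

(* Defs.v *)
From mathcomp Require Import all_boot.

Set Implicit Arguments.
Unset Strict Implicit.
Unset Printing Implicit Defensive.

(** * Arc-generated transformation semigroups *)

(* The vertex set {1, ..., n} is represented by 'I_n; the ordinal v stands for
   the vertex v.+1. *)
Definition transf (n : nat) := {ffun 'I_n -> 'I_n}.

(* Right action: v (f g) = (v f) g. *)
Definition tcomp n (f g : transf n) : transf n := [ffun v => g (f v)].

Definition arc_map n (a b : 'I_n) : transf n :=
  [ffun v => if v == a then b else v].

Definition arc_maps n (D : rel 'I_n) : {set transf n} :=
  [set arc_map p.1 p.2 | p : 'I_n * 'I_n & D p.1 p.2].

Definition is_subsemigroup n (S : {set transf n}) : bool :=
  [forall f in S, forall g in S, tcomp f g \in S].

Definition arc_semigroup n (D : rel 'I_n) : {set transf n} :=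
  \bigcap_(S : {set transf n} | (arc_maps D \subset S) && is_subsemigroup S) S.

(* A cycle has distinct points, hence length at most n. *)
Definition longest_cycle n (f : transf n) : nat :=
  \max_(m < n.+1 | [exists c : m.-tuple 'I_n, ucycleb (frel f) c]) m.

(* For a digraph without arcs the semigroup is empty and this is 0. *)
Definition max_cycle n (D : rel 'I_n) : nat :=
  \max_(f in arc_semigroup D) longest_cycle f.

(** * Random access machines *)

(* Unit-cost RAM without multiplication, with structured control flow in place
   of jumps.  It has registers, a read-only input memory, and a work memory;
   the last two are accessed by indirect addressing. *)
Inductive rhs :=
  | Cst of nat          (* constant *)
  | Add of nat & nat    (* r_i + r_j *)
  | Sub of nat & nat    (* r_i - r_j, truncated at 0 *)
  | Inp of nat          (* input[r_i] *)
  | Ld of nat.          (* mem[r_i] *)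

Inductive cmd :=
  | Skip
  | Assign of nat & rhs         (* r_i := rhs *)
  | Store of nat & nat          (* mem[r_i] := r_j *)
  | Seq of cmd & cmd
  | If of nat & cmd & cmd       (* test r_i <> 0 *)
  | While of nat & cmd.         (* test r_i <> 0 *)

Record state := State { reg : nat -> nat; mem : nat -> nat }.

Definition upd (f : nat -> nat) (i x : nat) : nat -> nat :=
  fun j => if j == i then x else f j.

Definition set_reg (s : state) i x := State (upd (reg s) i x) (mem s).
Definition set_mem (s : state) a x := State (reg s) (upd (mem s) a x).

Definition init_state : state := State (fun=> 0) (fun=> 0).

Definition eval_rhs (inp : nat -> nat) (s : state) (r : rhs) : nat :=
  match r with
  | Cst c => c
  | Add i j => reg s i + reg s j
  | Sub i j => reg s i - reg s j
  | Inp i => inp (reg s i)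
  | Ld i => mem s (reg s i)
  end.

(* [exec W inp c s t s']: on input memory inp, the command c started in s halts
   in s' after t unit-cost steps, and all words (values and addresses) occurring
   on the way are less than W.  An assignment that would overflow has no
   execution, so a program cannot gain speed by packing data into huge
   numbers. *)
Inductive exec (W : nat) (inp : nat -> nat) :
    cmd -> state -> nat -> state -> Prop :=
  | exec_skip s : exec W inp Skip s 1 s
  | exec_assign s i r :
      eval_rhs inp s r < W ->
      exec W inp (Assign i r) s 1 (set_reg s i (eval_rhs inp s r))
  | exec_store s i j :
      exec W inp (Store i j) s 1 (set_mem s (reg s i) (reg s j))
  | exec_seq c1 c2 s1 s2 s3 t1 t2 :
      exec W inp c1 s1 t1 s2 -> exec W inp c2 s2 t2 s3 ->
      exec W inp (Seq c1 c2) s1 (t1 + t2) s3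
  | exec_if_true i c1 c2 s s' t :
      reg s i != 0 -> exec W inp c1 s t s' ->
      exec W inp (If i c1 c2) s t.+1 s'
  | exec_if_false i c1 c2 s s' t :
      reg s i = 0 -> exec W inp c2 s t s' ->
      exec W inp (If i c1 c2) s t.+1 s'
  | exec_while_false i c s :
      reg s i = 0 -> exec W inp (While i c) s 1 s
  | exec_while_true i c s1 s2 s3 t1 t2 :
      reg s1 i != 0 -> exec W inp c s1 t1 s2 ->
      exec W inp (While i c) s2 t2 s3 ->
      exec W inp (While i c) s1 (t1 + t2).+1 s3.

(* Execution is deterministic, so "there is an execution" below means "the
   execution halts". *)
Lemma exec_det W inp c s t1 s1 t2 s2 :
  exec W inp c s t1 s1 -> exec W inp c s t2 s2 -> t1 = t2 /\ s1 = s2.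
Proof.
move=> H; elim: H t2 s2 => {c s t1 s1}; intros;
  match goal with H : exec _ _ _ _ ?t ?s |- _ = ?t /\ _ = ?s => inversion H end;
  subst => //;
  repeat match goal with
  | IH : forall t s, exec _ _ ?c ?s1 t s -> _, H : exec _ _ ?c ?s1 _ _ |- _ =>
      have [? ?] := IH _ _ H; clear H; subst
  end => //;
  by match goal with nz : is_true (?x != 0), z : ?x = 0 |- _ => rewrite z in nz end.
Qed.

(* The answer is read in register 0. *)
Definition ram_decides (W T : nat) (inp : nat -> nat) (p : cmd) (b : bool) :=
  exists t s, [/\ exec W inp p init_state t s, t <= T & (reg s 0 != 0) = b].

(** * Adjacency lists *)

(* The neighbours of each vertex are listed once, in an arbitrary order. *)
Definition adjacency_list n (e : rel 'I_n) (adj : 'I_n -> seq 'I_n) : Prop :=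
  forall u, uniq (adj u) /\ (forall v, (v \in adj u) = e u v).

(* The linked list s stored from address p on: the entry x occupies two words,
   x itself and the address of the next entry (0 at the end of the list). *)
Fixpoint list_cells (p : nat) (s : seq nat) : seq nat :=
  if s is x :: s' then
    [:: x, (if nilp s' then 0 else p.+2) & list_cells p.+2 s']
  else [::].

(* The addresses of the first entries of the lists ls (0 for an empty list),
   and their cells, when they are stored one after the other from p on. *)
Fixpoint list_heads (p : nat) (ls : seq (seq nat)) : seq nat :=
  if ls is s :: ls' then
    (if nilp s then 0 else p) :: list_heads (p + (size s).*2) ls'
  else [::].

Fixpoint all_cells (p : nat) (ls : seq (seq nat)) : seq nat :=
  if ls is s :: ls' then
    list_cells p s ++ all_cells (p + (size s).*2) ls'
  else [::].

(* Input memory: n at address 0; at address v, for v = 1, ..., n, the address of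
   the linked list of the neighbours of v; then the cells of these lists; then
   zeros. *)
Definition encode n (adj : 'I_n -> seq 'I_n) : nat -> nat :=
  let ls := [seq [seq (v : 'I_n).+1 | v <- adj u] | u <- enum 'I_n] in
  nth 0 (n :: list_heads n.+1 ls ++ all_cells n.+1 ls).

(* Main.v *)
(** A cycle of length m of an element of <G> is the same as m tokens that can be
    moved along the arcs, always into unoccupied vertices, so as to permute them
    cyclically.  Two such motions bound the shape of a connected graph G with
    l(G) <= k: a vertex of large degree lets many tokens rotate, and so does a
    spider with two long legs and a third leg of length one, since the top token
    of one leg can be parked while the others pass into the second leg.  Hence
    the middle part of a longest path of G consists of vertices of degree two,
    and only boundedly many vertices lie outside of it.

    Lengthening a path of vertices of degree two does not decrease l.  Thus, for
    a fixed rest s of the graph, "l(G) <= k" can only switch from true to false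
    when the path gets longer, and as there are finitely many s, the truth value
    depends only on s and on min(length, T), for some constant T.

    The machine therefore tries the boundedly many first vertices as starting
    points, one of which lies on the long path.  From there it walks to one end of
    the path of vertices of degree two, walks back to the other end marking the
    interior vertices, collects the unmarked vertices, and, if there are few of
    them, looks the answer up in a finite table. *)
From Stdlib Require Import ClassicalEpsilon.
Require Import Defs.
From mathcomp Require Import all_boot zify.

Set Implicit Arguments.
Unset Strict Implicit.
Unset Printing Implicit Defensive.

(** * Token motions *)

Lemma tcompE n (f g : transf n) v : tcomp f g v = g (f v).
Proof. by rewrite ffunE. Qed.

Lemma arc_mapE n (a b v : 'I_n) : arc_map a b v = if v == a then b else v.
Proof. by rewrite ffunE. Qed.

Section ArcSemigroup.

Variables (n : nat) (D : rel 'I_n).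

Lemma arc_map_sg a b : D a b -> arc_map a b \in arc_semigroup D.
Proof.
move=> Dab; apply/bigcapP => S /andP[/subsetP sub _]; apply: sub.
by apply/imsetP; exists (a, b); rewrite ?inE.
Qed.

Lemma tcomp_sg f g :
  f \in arc_semigroup D -> g \in arc_semigroup D ->
  tcomp f g \in arc_semigroup D.
Proof.
move=> /bigcapP Hf /bigcapP Hg; apply/bigcapP => S HS.
have /andP[_ /forall_inP HS2] := HS.
by have /forall_inP := HS2 _ (Hf _ HS); apply; apply: Hg.
Qed.

Lemma arc_semigroup_ind (P : pred (transf n)) :
  (forall a b, D a b -> P (arc_map a b)) ->
  (forall f g, P f -> P g -> P (tcomp f g)) ->
  forall f, f \in arc_semigroup D -> P f.
Proof.
move=> Parc Pcomp f /bigcapP /(_ [set g | P g]); rewrite inE; apply.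
apply/andP; split.
  apply/subsetP => _ /imsetP[[a b] + ->]; rewrite !inE; exact: Parc.
apply/forall_inP => g; rewrite inE => Pg; apply/forall_inP => h.
by rewrite !inE; apply: Pcomp.
Qed.

Lemma fpath_map (f : transf n) x p : fpath f x p = (map f (belast x p) == p).
Proof. by elim: p x => [|y p IH] x //=; rewrite IH eqseq_cons. Qed.

Lemma fcycle_rot (f : transf n) s : fcycle f s = (map f s == rot 1 s).
Proof. by case: s => [|x s] //=; rewrite fpath_map belast_rcons rot1_cons. Qed.

Lemma max_cycle_leP m :
  reflect (forall f s, f \in arc_semigroup D -> uniq s -> map f s = rot 1 s ->
             size s <= m)
    (max_cycle D <= m).
Proof.
apply: (iffP (bigmax_leqP _ _ _)) => [H f s fD us fs|H f fD].
  have lt_s : size s < n.+1 by rewrite ltnS -(card_uniqP us) -[leqRHS]card_ord max_card.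
  apply: leq_trans (H f fD); apply: (leq_bigmax_cond (Ordinal lt_s)).
  apply/existsP; exists (in_tuple s).
  by rewrite /ucycleb /= us fcycle_rot fs eqxx.
apply/bigmax_leqP => -[l lt_l] /= /existsP[c /andP[fc uc]].
rewrite -[l](size_tuple c); apply: H fD _ _ => //.
by apply/eqP; rewrite -fcycle_rot.
Qed.

End ArcSemigroup.

(* The moves of <D1> are carried out in <D2> on the image of phi. *)
Lemma max_cycle_simulation n1 n2 (D1 : rel 'I_n1) (D2 : rel 'I_n2)
    (phi : 'I_n1 -> 'I_n2) :
  injective phi ->
  (forall a b, D1 a b -> exists2 g, g \in arc_semigroup D2 &
     forall v, g (phi v) = phi (arc_map a b v)) ->
  max_cycle D1 <= max_cycle D2.
Proof.
move=> phi_inj sim.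
have {}sim f : f \in arc_semigroup D1 ->
    [exists g in arc_semigroup D2, [forall v, g (phi v) == phi (f v)]].
  move: f; apply: arc_semigroup_ind => [a b /sim[g gD gE]|f1 f2].
    by apply/exists_inP; exists g => //; apply/forallP => v; rewrite gE.
  move=> /exists_inP[g1 g1D /forallP E1] /exists_inP[g2 g2D /forallP E2].
  apply/exists_inP; exists (tcomp g1 g2); first exact: tcomp_sg.
  by apply/forallP => v; rewrite !tcompE (eqP (E1 _)).
apply/max_cycle_leP => f s /sim/exists_inP[g gD /forallP gE] us fs.
rewrite -(size_map phi); apply: (max_cycle_leP D2 _ (leqnn _) g) => //.
  by rewrite map_inj_uniq.
by rewrite -map_rot -fs -!map_comp; apply: eq_map => v /=; apply/eqP/gE.
Qed.

Lemma uniq_mid (T : eqType) (s1 s2 : seq T) x :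
  uniq (s1 ++ x :: s2) = (x \notin s1 ++ s2) && uniq (s1 ++ s2).
Proof. by rewrite -[s2]/([::] ++ s2) -cat1s uniq_catCA. Qed.

(** Comparing counts turns uniqueness of a rearranged sublist into linear arithmetic; [uniq_sub]
    below leaves such goals to [lia]. *)
Lemma uniq_count_sub (T : eqType) (t s : seq T) :
  uniq t -> (forall P : pred T, count P s <= count P t) -> uniq s.
Proof.
move=> ut le_st; apply/count_mem_uniq => x.
rewrite -has_pred1 has_count; have := le_st (pred1 x).
by rewrite (count_uniq_mem _ ut); case: (count _ s) (x \in t) => [|[|c]] [].
Qed.

Lemma uniq_consN (T : eqType) (x : T) s : uniq (x :: s) -> x \notin s.
Proof. by case/andP. Qed.

Ltac uniq_sub H :=
  apply: (uniq_count_sub H); intros ?;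
  rewrite /= -?cats1 /= ?(count_cat, count_rev) /= ?(count_cat, count_rev) /=;
  repeat match goal with H' : ?T |- _ => match type of T with Prop => clear H' end end;
  lia.

Section Moves.

Variables (n : nat) (D : rel 'I_n).

(* Tokens are moved from the points of [s] to those of [s']. *)
Definition moves (s s' : seq 'I_n) :=
  s = s' \/ exists2 f, f \in arc_semigroup D & map f s = s'.

Lemma moves_trans s2 s1 s3 : moves s1 s2 -> moves s2 s3 -> moves s1 s3.
Proof.
case=> [->//|[f fD <-]] [<-|[g gD <-]]; right; first by exists f.
exists (tcomp f g); first exact: tcomp_sg.
by rewrite -map_comp; apply: eq_map => v; rewrite tcompE.
Qed.

Lemma moves_rev s s' : moves s s' -> moves (rev s) (rev s').
Proof.
by case=> [->|[f fD <-]]; [left | right; exists f; rewrite // map_rev].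
Qed.

Lemma moves_arc s1 a b s2 :
  D a b -> a \notin s1 ++ s2 -> moves (s1 ++ a :: s2) (s1 ++ b :: s2).
Proof.
rewrite mem_cat negb_or => Dab /andP[a1 a2]; right.
exists (arc_map a b); first exact: arc_map_sg.
have fix_id s : a \notin s -> map (arc_map a b) s = s.
  move=> aNs; rewrite -[RHS]map_id; apply/eq_in_map => v vs.
  by rewrite arc_mapE; case: eqP => // va; rewrite -va vs in aNs.
by rewrite map_cat /= arc_mapE eqxx !fix_id.
Qed.

Lemma moves_path s1 a p s2 :
  path D a p -> uniq (s1 ++ a :: s2) -> all (fun v => v \notin s1 ++ s2) p ->
  moves (s1 ++ a :: s2) (s1 ++ last a p :: s2).
Proof.
elim: p a => [|b p IH] a /=; first by left.
move=> /andP[Dab Dp] us /andP[bN pN].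
move: us; rewrite uniq_mid => /andP[aN us].
by apply: moves_trans (moves_arc Dab aN) (IH _ Dp _ pN); rewrite uniq_mid bN.
Qed.

(** A list of at least two distinct points differs from its rotation, so the motion is not the empty
    one and comes from an element of the semigroup. *)
Lemma moves_rot s : 1 < size s -> uniq s -> moves s (rot 1 s) ->
  size s <= max_cycle D.
Proof.
move=> sz us [E|[f fD fs]]; last exact: (max_cycle_leP D _ (leqnn _) f).
case: s sz us E => [|x [|y s]] //= _ /andP[xN _]; rewrite rot1_cons => -[xy _].
by rewrite xy mem_head in xN.
Qed.

(* All tokens of a stack move one step ahead, the leading one first. *)
Lemma moves_shift1 s1 a p s2 :
  path D a p -> uniq (s1 ++ (a :: p) ++ s2) ->
  moves (s1 ++ belast a p ++ s2) (s1 ++ p ++ s2).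
Proof.
elim/last_ind: p s2 => [|p b IH] s2; first by left.
rewrite rcons_path => /andP[{}/IH IH Db] us.
have us' : uniq (s1 ++ (a :: p) ++ b :: s2).
  by move: us; rewrite -rcons_cons -cats1 -catA.
rewrite belast_rcons lastI -!cats1 -!catA /=.
apply: moves_trans (IH (b :: s2) us').
rewrite !catA; apply: moves_arc Db _.
move: us'; rewrite lastI -cats1 -!catA /= catA uniq_mid => /andP[+ _].
by rewrite !mem_cat inE !negb_or => /andP[/andP[-> ->]] /andP[_ ->].
Qed.

(** Iterates [moves_shift1]: a block at the start of a path advances step by step until it fills the
    end of the path. *)
Lemma moves_shift s1 s2 s t s' t' :
  s ++ t = t' ++ s' -> size s = size s' ->
  sorted D (s ++ t) -> uniq (s1 ++ (s ++ t) ++ s2) ->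
  moves (s1 ++ s ++ s2) (s1 ++ s' ++ s2).
Proof.
elim: t s t' => [|b t IH] s t' E sz.
  have t'0 : size t' = 0 by have /(congr1 size) := E; rewrite !size_cat /= sz; lia.
  by case: t' t'0 E => //= _; rewrite cats0 => <-; left.
case: s sz E => [|a s] /= sz E Ds us; first by case: s' sz {E IH}; left.
case: t' E => [E|a' t' [_ E]].
  by have /(congr1 size) := E; rewrite /= !size_cat /= -?sz /=; lia.
have Ds' : path D a (rcons s b ++ t) by rewrite cat_rcons.
have us' : uniq (s1 ++ (rcons s b ++ t) ++ s2).
  by uniq_sub us.
apply: (@moves_trans (s1 ++ rcons s b ++ s2)).
  rewrite -[a :: s ++ s2]/((a :: s) ++ s2) -(belast_rcons a s b).
  apply: moves_shift1; first by move: Ds'; rewrite cat_path => /andP[].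
  by uniq_sub us.
apply: IH us'; [by rewrite cat_rcons E|by rewrite size_rcons|].
by move: Ds'; case: (rcons s b ++ t) => //= x q /andP[].
Qed.

(** Reading the tokens backwards turns this rotation into [rot 1]. *)
Lemma moves_rotr s a : 0 < size s -> uniq (rcons s a) ->
  moves (rcons s a) (a :: s) -> (size s).+1 <= max_cycle D.
Proof.
move=> sz us /moves_rev; rewrite rev_rcons rev_cons => mv.
rewrite -(size_rev s) -[_.+1]/(size (a :: rev s)) moves_rot //=.
- by rewrite ltnS size_rev.
- by move: us; rewrite rcons_uniq mem_rev rev_uniq.
- by rewrite rot1_cons.
Qed.

Lemma moves_hop s1 a c b s2 : D a c -> D c b ->
  uniq (s1 ++ a :: s2) -> c \notin s1 ++ s2 -> b \notin s1 ++ s2 ->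
  moves (s1 ++ a :: s2) (s1 ++ b :: s2).
Proof.
move=> Dac Dcb us cN bN.
by apply: (@moves_path _ _ [:: c; b]) => //=; rewrite ?Dac ?Dcb ?cN ?bN.
Qed.

End Moves.

(** * Stars and spiders force long cycles *)

Section Obstructions.

Variables (n : nat) (D : rel 'I_n).
Hypothesis D_sym : symmetric D.

(** The tokens occupy the leaves [a :: r], and [h] is free. Through the centre [c], the token of [a]
    is parked at [h], each remaining token in turn hops to the leaf just vacated, and the parked one
    takes the last leaf. *)
Lemma max_cycle_star c a h r :
  all (D c) (h :: a :: r) -> uniq [:: c, h, a & r] -> 0 < size r ->
  (size r).+1 <= max_cycle D.
Proof.
move=> Dc us r_gt0.
have shift u b q : all (D c) (b :: q) -> uniq (c :: u ++ b :: q) ->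
    moves D (u ++ q) (u ++ belast b q).
  elim: q u b => [|y q IH] u b; first by left.
  move=> /and3P[Db Dy Dq] uq.
  apply: (@moves_trans _ _ (u ++ b :: q)).
    apply: (moves_hop (c := c)) => //; first by rewrite D_sym.
    - by uniq_sub uq.
    - by apply: uniq_consN; uniq_sub uq.
    - by apply: uniq_consN; uniq_sub uq.
  have := IH (rcons u b) y; rewrite !cat_rcons; apply => //.
  by apply/andP.
have us' : uniq [:: c, h & rcons (belast a r) (last a r)] by rewrite -lastI.
have [Dh /andP[Da _]] := andP Dc.
have Dl : D c (last a r).
  by have /allP := Dc; apply; rewrite inE mem_last orbT.
rewrite -(size_belast a r); apply: (@moves_rotr _ _ _ (last a r)).
- by rewrite size_belast.
- by rewrite -lastI; uniq_sub us.
rewrite -lastI; apply: (@moves_trans _ _ (h :: r)).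
  apply: (@moves_hop _ _ [::] a c h r) => //; first by rewrite D_sym.
  - by uniq_sub us.
  - by apply: uniq_consN; uniq_sub us.
  - by apply: uniq_consN; uniq_sub us.
apply: (@moves_trans _ _ (h :: belast a r)).
  by apply: (shift [:: h]); [case/andP: Dc|uniq_sub us].
apply: (@moves_hop _ _ [::] h c (last a r) (belast a r)) => //.
- by rewrite D_sym.
- by uniq_sub us'.
- by apply: uniq_consN; uniq_sub us'.
- by apply: uniq_consN; uniq_sub us'.
Qed.

Lemma sorted_rev_cat c A B :
  path D c A -> path D c B -> sorted D (rev A ++ c :: B).
Proof.
move=> DA DB; have : sorted D (rcons (rev A) c).
  by rewrite -rev_cons rev_sorted; apply: sub_path DA => x y; rewrite D_sym.
rewrite -cat_rcons; case: (rev A) => [|y q] //=.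
by rewrite cat_path last_rcons => ->.
Qed.

(* The stack A has its top a next to c.  The top token is parked at x, the other
   ones pass through c into B, the first one goes to the bottom of A, and the
   other ones come back. *)
Lemma max_cycle_spider c x A B :
  path D c A -> path D c B -> D c x -> uniq [:: x, c & A ++ B] ->
  0 < size B -> size A = (size B).+1 -> size A <= max_cycle D.
Proof.
case: A => // a A DA DB Dx us B_gt0 [szAB].
have [Dca DaA] := andP DA.
set z := last a A; set A' := belast a A.
have EA : a :: A = rcons A' z by rewrite lastI.
have szA' : size A' = size B by rewrite size_belast.
have Drev := sorted_rev_cat DA DB.
have Drev' := sorted_rev_cat DB DA.
rewrite -(size_rev (a :: A)) EA rev_rcons.
have urev : uniq (z :: rev A') by rewrite -rev_rcons -EA; uniq_sub us.
suff mv : moves D (z :: rev A') (rcons (rev A') z).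
  by apply: moves_rot => //; rewrite ?rot1_cons //= size_rev szA'.
rewrite -rev_rcons -EA rev_cons -[rcons _ _]cats1.
apply: (@moves_trans _ _ (rev A ++ [:: x])).
  apply: (moves_hop (c := c)) => //; first by rewrite D_sym.
  - by uniq_sub us.
  - by apply: uniq_consN; uniq_sub us.
  - by apply: uniq_consN; uniq_sub us.
(* As [size A = size B] by now, the tokens below the top one fill [B] exactly and leave [c] free for
   the parked token. *)
apply: (@moves_trans _ _ (B ++ [:: x])).
  apply: (@moves_shift _ _ [::] [:: x] _ (a :: c :: B) B (rcons (rcons (rev A) a) c)).
  - by rewrite !cat_rcons.
  - by rewrite size_rev.
  - by move: Drev; rewrite rev_cons cat_rcons.
  - by uniq_sub us.
apply: (@moves_trans _ _ (B ++ [:: z])).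
  apply: (@moves_path _ _ _ _ [:: c, a & A]).
  - by rewrite /= D_sym Dx Dca.
  - by uniq_sub us.
  - rewrite cats0; apply/allP => v vA.
    have : uniq ((c :: a :: A) ++ B) by uniq_sub us.
    by rewrite cat_uniq => /and3P[_ /hasPn vN _]; apply/negP => /vN/negP.
(* Read backwards, the tokens in [B] form a block that advances along [rev B ++ c :: A'] into
   [A']. *)
have -> : rcons (rev A') z = rev (z :: A') by rewrite rev_cons.
rewrite -[B ++ _]revK rev_cat; apply: moves_rev.
have := @moves_shift _ D [:: z] [::] (rev B) (c :: A') A' (rcons (rev B) c).
rewrite !cats0; apply; rewrite ?cat_rcons ?size_rev //.
  move: Drev'; rewrite EA -cats1 -cat_cons catA.
  by case: (rev B ++ _) => //= y q; rewrite cat_path => /andP[].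
have us3 : uniq [:: x, c & rcons A' z ++ B] by rewrite -EA.
by uniq_sub us3.
Qed.

End Obstructions.

(** * Graphs without long cycles *)

Section Structure.

Variables (n : nat) (e : rel 'I_n) (k : nat).
Hypotheses (e_irr : irreflexive e) (e_sym : symmetric e).
Hypothesis e_conn : forall u v : 'I_n, connect e u v.
Hypothesis le_k : max_cycle e <= k.

(** A vertex of degree d >= 3 is the centre of a star with d - 1 tokens, so d is at most [k.+1]; the
    bound [k.+2] also covers degrees up to two. *)
Lemma degree_bound v : #|e v| <= k.+2.
Proof.
have := enum_uniq (e v); have : {in enum (e v), forall w, e v w}.
  by move=> w; rewrite mem_enum.
rewrite cardE; case: (enum _) => [|h [|a [|b r]]] // ev us.
suff : (size (b :: r)).+1 <= max_cycle e by move: le_k => /=; lia.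
apply: (@max_cycle_star _ _ e_sym v a h (b :: r)) => //.
  by apply/allP.
by rewrite cons_uniq us andbT; apply/negP => /ev; rewrite e_irr.
Qed.

Lemma no_spider v x A B : path e v A -> path e v B -> e v x ->
  uniq [:: x, v & A ++ B] -> k.+2 <= size A -> k.+1 <= size B -> False.
Proof.
move=> eA eB ex us szA szB; 
have := @max_cycle_spider _ _ e_sym v x (take k.+2 A) (take k.+1 B).
rewrite !size_takel // => H.
suff : k.+2 <= max_cycle e by lia.
apply: H => //; try exact: take_path.
apply: (uniq_count_sub us) => P /=.
rewrite !count_cat -{2}(cat_take_drop k.+2 A) -{2}(cat_take_drop k.+1 B).
by rewrite !count_cat; lia.
Qed.

(** A neighbour [w] in [B] beyond its head splits [B]. If the part from [w] on is long, it is a leg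
    and the head of [B] is the short leg; otherwise the part before [w] is long and [w] is the short
    leg. Either way [A] completes a forbidden spider. *)
Lemma path_nbr_r v w A B : path e v A -> path e v B -> uniq (v :: A ++ B) ->
  k.+2 <= size A -> k.+2.*2 <= size B -> e v w -> w \in B -> w = head v B.
Proof.
move=> eA eB us szA szB ew wB; apply/eqP/negPn/negP => wh.
case/splitPr: wB eB us szB wh => -[|h q1] q2; first by rewrite /= eqxx.
move=> eB us; rewrite size_cat /= => szB _.
move: eB; rewrite cat_path /= => /andP[/andP[eh eq1] /andP[el eq2]].
have [sz|sz] := leqP k.+1 (size q2).+1.
  apply: (@no_spider v h A (w :: q2)) => //; first by rewrite /= ew.
  by uniq_sub us.
apply: (@no_spider v w A (h :: q1)) => //; first by rewrite /= eh.
  by uniq_sub us.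
by move: szB sz; rewrite /=; move: (size q1) (size q2) => a b; lia.
Qed.

Lemma path_nbr v w A B : path e v A -> path e v B -> uniq (v :: A ++ B) ->
  k.+2.*2 <= size A -> k.+2.*2 <= size B -> e v w -> w = head v A \/ w = head v B.
Proof.
move=> eA eB us szA szB ew.
have [wA|wA] := boolP (w \in A).
  left; apply: (@path_nbr_r v w B A) => //; last by lia.
  by uniq_sub us.
have [wB|wB] := boolP (w \in B).
  by right; apply: (@path_nbr_r v w A B) => //; lia.
case: (@no_spider v w A B) => //; [|by lia|by lia].
rewrite cons_uniq us andbT inE mem_cat !negb_or wA wB !andbT.
by apply: contraTneq ew => ->; rewrite e_irr.
Qed.

Definition grow (X : {set 'I_n}) := X :|: \bigcup_(v in X) [set w | e v w].

Lemma card_grow X : #|grow X| <= #|X| * k.+3.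
Proof.
apply: leq_trans (leq_card_setU _ _) _; rewrite mulnS leq_add2l.
rewrite -sum_nat_const; apply: leq_trans (_ : \sum_(v in X) #|[set w | e v w]| <= _).
  elim/big_rec2: _ => [|v m Y _ le_m]; first by rewrite cards0.
  by apply: leq_trans (leq_card_setU _ _) _; rewrite leq_add2l.
by apply: leq_sum => v _; rewrite cardsE; apply: degree_bound.
Qed.

Lemma card_iter_grow d X : #|iter d grow X| <= #|X| * k.+3 ^ d.
Proof.
elim: d => [|d IH] /=; first by rewrite muln1.
by apply: leq_trans (card_grow _) _; rewrite expnSr mulnA leq_mul2r IH orbT.
Qed.

Lemma mem_iter_grow d (X : {set 'I_n}) v p : v \in X -> path e v p -> size p <= d ->
  last v p \in iter d grow X.
Proof.
elim: d X v p => [|d IH] X v [|w p] //= vX.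
  by move=> _ _; rewrite -iterS iterSr; apply: (IH _ v [::]) => //; rewrite inE vX.
case/andP=> ew ep sz; rewrite -iterS iterSr; apply: IH => //.
by rewrite inE; apply/orP; right; apply/bigcupP; exists v; rewrite ?inE.
Qed.

Lemma longest_path : exists P, [/\ sorted e P, uniq P &
  forall Q, sorted e Q -> uniq Q -> size Q <= size P].
Proof.
pose good d := [exists t : d.-tuple 'I_n, sorted e t && uniq t].
have good0 : exists d, good d by exists 0; apply/existsP; exists [tuple].
have good_le d : good d -> d <= n.
  case/existsP=> t /andP[_ /card_uniqP].
  by rewrite size_tuple => <-; rewrite -[leqRHS]card_ord max_card.
case: (ex_maxnP good0 good_le) => d /existsP[t /andP[st ut]] tmax.
exists t; split=> // Q sQ uQ; rewrite size_tuple; apply: tmax.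
by apply/existsP; exists (in_tuple Q); rewrite sQ.
Qed.

Lemma sorted_split l v r : sorted e (l ++ v :: r) -> path e v (rev l) /\ path e v r.
Proof.
rewrite -cat_rcons => sP; split; last first.
  by case: l sP => [|x l] //=; rewrite cat_path last_rcons => /andP[].
have : sorted e (rcons l v) by case: l sP => [|x l] //=; rewrite cat_path => /andP[].
rewrite -rev_sorted rev_rcons /=.
by apply: sub_path => x y; rewrite e_sym.
Qed.

(** If [A] is empty, putting [Q] in its place gives a longer path. Otherwise the first vertex of [A]
    is the short leg of a spider with long legs [B] and [Q]. *)
Lemma no_branch P y A B Q : (forall Q, sorted e Q -> uniq Q -> size Q <= P) ->
  path e y A -> path e y B -> path e y Q -> uniq (y :: A ++ B ++ Q) ->
  P = (size A + size B).+1 -> k.+2 <= size Q -> k.+2 <= size B -> False.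
Proof.
move=> Pmax eA eB eQ us EP szQ szB; case: A eA us EP => [|x A] eA us EP.
  have := Pmax _ (sorted_rev_cat e_sym eB eQ).
  rewrite size_cat size_rev /= EP.
  suff u : uniq (rev B ++ y :: Q) by move=> /(_ u) /=; lia.
  by uniq_sub us.
apply: (@no_spider y x B Q) => //; [by case/andP: eA| |by lia].
by uniq_sub us.
Qed.

(** Let R = 2(k + 2). The first term bounds the whole graph if its longest path has fewer than 2R
    vertices; the second bounds the set of vertices within distance k + 2 of the R vertices at
    either end of a longest path. *)
Definition chain_bound := maxn (k.+3 ^ k.+2.*2.*2.+1) (k.+2.*2.*2 * k.+3 ^ k.+2).

(** [C] is a longest path without R vertices at each end. Its vertices have degree two by
    [path_nbr], and every other vertex is near one of the removed ends. *)
Lemma long_chain : chain_bound < n -> exists C : seq 'I_n,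
  [/\ sorted e C, {in C, forall v, #|e v| = 2} & #|[predC C]| <= chain_bound].
Proof.
rewrite gtn_max => /andP[n1 n2].
have [P [sP uP Pmax]] := longest_path.
set R := k.+2.*2.
have [szP|szP] := ltnP (size P) R.*2.
  have n_gt0 : 0 < n by apply: leq_ltn_trans n1.
  suff : n <= k.+3 ^ R.*2.+1 by rewrite leqNgt n1.
  have := card_iter_grow R.*2.+1 [set Ordinal n_gt0].
  rewrite cards1 mul1n; apply: leq_trans; rewrite -[leqLHS]card_ord.
  apply/subset_leq_card/subsetP => u _.
  have /connectP[p0 ep0 ->] := e_conn (Ordinal n_gt0) u.
  case/shortenP: ep0 => p ep up _; apply: mem_iter_grow => //; first by rewrite inE.
  by have := Pmax (_ :: p) ep up; rewrite /=; lia.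
set l1 := take R P; set C := take (size P - R.*2) (drop R P).
set l2 := drop (size P - R.*2) (drop R P).
have EP : P = l1 ++ C ++ l2 by rewrite !cat_take_drop.
have sz1 : size l1 = R by rewrite size_takel //; lia.
have sz2 : size l2 = R by rewrite !size_drop; lia.
have sC : sorted e C by apply/take_sorted/drop_sorted.
clearbody l1 C l2.
have inC v : v \in C -> exists A B, [/\ path e v A, path e v B, uniq (v :: A ++ B),
    (R <= size A) && (R <= size B) & {subset A ++ B <= P}].
  move=> vC; case/splitPr: vC EP => c1 c2 EP.
  have := sP; rewrite EP -(catA c1) cat_cons catA => /sorted_split[eA eB].
  exists (rev (l1 ++ c1)), (c2 ++ l2); split=> //.
  - by move: uP; rewrite EP => uP; uniq_sub uP.
  - by rewrite size_rev !size_cat; lia.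
  - move=> w; rewrite mem_cat mem_rev !mem_cat inE !mem_cat.
    by case/orP=> /orP[] ->; rewrite ?orbT.
exists C; split=> //.
- move=> v /inC[[|a A] [[|b B] [eA eB us /andP[szA szB] _]]] //.
  have ab : a != b.
    rewrite -(mem_seq1 a b); apply: uniq_consN; uniq_sub us.
  transitivity #|[set a; b]|; last by rewrite cards2 ab.
  apply: eq_card => w.
  rewrite !inE unfold_in; apply/idP/idP => [ew|].
    by case: (path_nbr eA eB us szA szB ew) => ->; rewrite eqxx ?orbT.
  by case/orP=> /eqP->; [case/andP: eA|case/andP: eB].
apply: leq_trans (leq_maxr _ _).
have := card_iter_grow k.+2 [set v in l1 ++ l2].
have -> : #|[set v in l1 ++ l2]| = k.+2.*2.*2.
  rewrite cardsE; have /card_uniqP -> : uniq (l1 ++ l2).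
    by move: uP; rewrite EP => uP; uniq_sub uP.
  by rewrite size_cat sz1 sz2 addnn.
apply: leq_trans; apply/subset_leq_card/subsetP => u uC0.
have {uC0} uC : u \notin C by move: uC0; rewrite inE.
have memP v : v \in P -> v \notin C -> v \in l1 ++ l2.
  by rewrite EP !mem_cat => /or3P[] -> //; rewrite orbT.
have [uP'|uNP] := boolP (u \in P).
  by apply: (@mem_iter_grow _ _ u [::]) => //; rewrite inE memP.
have [x xP] : exists x, x \in P.
  by case: (P) szP => [|x q] //; exists x; rewrite mem_head.
have /connectP[q0 eq0 Ex] := e_conn u x.
case/shortenP: eq0 Ex => q eq uq _ Ex.
have hasq : has [in P] q.
  apply/hasP; exists x => //.
  by move: (mem_last u q); rewrite -Ex inE => /predU1P[xu|//]; rewrite -xu xP in uNP.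
(* [y] is the first vertex of [P] on the way from [u]. *)
case: {Ex}(split_find hasq) eq uq => y q1 q2 yP q1N.
rewrite cat_path last_rcons -cat_cons -rcons_cons => /andP[eq _].
rewrite cat_uniq => /and3P[uq _ _].
have eQ : path e y (rev (u :: q1)).
  have /(@sorted_split (u :: q1)) [] // : sorted e ((u :: q1) ++ [:: y]).
  by rewrite cats1.
have QN v : v \in u :: q1 -> v \notin P.
  by rewrite inE => /predU1P[->//|vq]; apply/negP => vP; case/hasP: q1N; exists v.
(* The vertex before [y] lies off [P], whereas all neighbours of a vertex of [C] are on [P]. *)
have yC : y \notin C.
  apply/negP => /inC[A [B [eA eB us /andP[szA szB] sub]]].
  have ey : e y (last u q1) by rewrite e_sym; move: eq; rewrite /= rcons_path => /andP[].
  have /negP := QN _ (mem_last u q1); apply; apply: sub; rewrite mem_cat.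
  have hd (q' : seq 'I_n) : R <= size q' -> head y q' \in q'.
    by case: q' => //= ? ?; rewrite mem_head.
  by case: (path_nbr eA eB us szA szB ey) => ->; rewrite hd ?orbT.
have [szq|szq] := leqP (size (u :: q1)) k.+2.
  have -> : u = last y (rev (u :: q1)) by rewrite rev_cons last_rcons.
  by apply: mem_iter_grow; rewrite ?size_rev // inE memP.
(* A longer connection would be a long branch at [y], where at least one of the two arms of [P] is
   long too. *)
exfalso; have disj : uniq (P ++ u :: q1).
  rewrite cat_uniq; apply/and3P; split=> //; last by uniq_sub uq.
  by apply/hasPn => v /QN.
case/splitPr: yP sP disj szP Pmax => l r /sorted_split[eA eB] disj.
rewrite size_cat /= => szP Pmax; have [szl|szl] := leqP k.+2 (size l).
  apply: (@no_branch _ y r (rev l) _ Pmax eB eA eQ); rewrite ?size_rev //.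
  - by uniq_sub disj.
  - by rewrite addnS addnC.
  - exact: ltnW.
apply: (@no_branch _ y (rev l) r _ Pmax eA eB eQ); rewrite ?size_rev //.
- by uniq_sub disj.
- by rewrite addnS.
- exact: ltnW.
- by move: szl szP; rewrite /R; move: (size l) (size r) => a b; clear; lia.
Qed.

End Structure.

(** * Lengthening a path *)

(* The graph consists of the vertices [s] and of a path from [a] to [b], with
   [a] and [b] in [s], whose interior vertices [x] have degree two. *)
Record chain_dec n (e : rel 'I_n) (s x : seq 'I_n) (a b : 'I_n) : Prop := ChainDec {
  chain_uniq : uniq (s ++ x);
  chain_all : forall v, v \in s ++ x;
  chain_start : a \in s;
  chain_end : b \in s;
  chain_path : path e a (rcons x b);
  chain_nbr : forall i w, i < size x -> e (nth a x i) w ->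
    w = nth a (a :: x) i \/ w = nth a (rcons x b) i.+1 }.

(** Bit lists describe [s] and the two ends independently of the ambient graph, so bounded size
    leaves finitely many descriptions. *)
Definition position_bits (T : eqType) (s : seq T) (a : T) := [seq v == a | v <- s].
Definition adjacency_bits (T : Type) (e : rel T) (s : seq T) :=
  [seq e u v | u <- s, v <- s].

Section Subdivision.

Variables (n1 n2 : nat) (e1 : rel 'I_n1) (e2 : rel 'I_n2).
Hypotheses (sym1 : symmetric e1) (sym2 : symmetric e2).
Variables (s1 x1 : seq 'I_n1) (a1 b1 : 'I_n1).
Variables (s2 x2 : seq 'I_n2) (a2 b2 : 'I_n2).
Hypotheses (dec1 : chain_dec e1 s1 x1 a1 b1) (dec2 : chain_dec e2 s2 x2 a2 b2).
Hypothesis same_start : position_bits s1 a1 = position_bits s2 a2.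
Hypothesis same_end : position_bits s1 b1 = position_bits s2 b2.
Hypothesis same_adj : adjacency_bits e1 s1 = adjacency_bits e2 s2.
Hypothesis le_x : size x1 <= size x2.

Let size_s : size s1 = size s2.
Proof. by have /(congr1 size) := same_start; rewrite !size_map. Qed.

(** [s1] is matched with [s2], and [x1] with the first vertices of [x2]; the surplus of [x2] lies
    between the last of these and [b2]. *)
Let phi v := nth a2 (s2 ++ x2) (index v (s1 ++ x1)).

Let phi_s v : v \in s1 -> phi v = nth a2 s2 (index v s1).
Proof. by move=> vs; rewrite /phi index_cat vs nth_cat -size_s index_mem vs. Qed.

Let phi_x i : i < size x1 -> phi (nth a1 x1 i) = nth a2 x2 i.
Proof.
move=> lt_i; have := chain_uniq dec1; rewrite cat_uniq => /and3P[_ /hasPn xNs ux].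
rewrite /phi index_cat (negbTE (xNs _ (mem_nth _ lt_i))) nth_cat index_uniq //.
by rewrite size_s ltnNge leq_addr addKn.
Qed.

Let lt_index v : index v (s1 ++ x1) < size (s2 ++ x2).
Proof.
apply: leq_trans (_ : size (s1 ++ x1) <= _).
  by rewrite index_mem (chain_all dec1).
by rewrite !size_cat size_s leq_add2l.
Qed.

Let phi_inj : injective phi.
Proof.
move=> u v /eqP; rewrite nth_uniq ?(chain_uniq dec2) // => /eqP Euv.
rewrite -(nth_index u (chain_all dec1 u)) Euv; apply: nth_index.
exact: chain_all dec1 v.
Qed.

Let same_index c d : c \in s1 -> position_bits s1 c = position_bits s2 d -> phi c = d.
Proof.
move=> cs /(congr1 (nth false ^~ (index c s1))); rewrite phi_s //.
have lt_c : index c s1 < size s1 by rewrite index_mem.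
rewrite (nth_map c) // (nth_map d) -?size_s // nth_index // eqxx => /esym/eqP.
by move=> E; rewrite -[RHS]E; apply: set_nth_default; rewrite -size_s.
Qed.

Let same_arc u v : u \in s1 -> v \in s1 -> e2 (phi u) (phi v) = e1 u v.
Proof.
move=> us vs; rewrite !phi_s //.
have lt_u : index u s1 < size s1 by rewrite index_mem.
have lt_v : index v s1 < size s1 by rewrite index_mem.
have /eq_from_flatten_shape E := same_adj.
have {E} /E : shape [seq [seq e1 x y | y <- s1] | x <- s1] =
              shape [seq [seq e2 x y | y <- s2] | x <- s2].
  rewrite /shape -!map_comp; apply: (@eq_from_nth _ 0); rewrite ?size_map // => i lt_i.
  by rewrite (nth_map u) // (nth_map a2) -?size_s //= !size_map.
move=> /(congr1 (fun t => nth false (nth [::] t (index u s1)) (index v s1))).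
rewrite (nth_map u) // (nth_map a2) -?size_s // (nth_map u) // (nth_map a2) -?size_s //.
by rewrite !nth_index.
Qed.

Let simulated u v := exists2 g, g \in arc_semigroup e2 &
  forall w, g (phi w) = phi (arc_map u v w).

(** The interior of the path avoids the image of [phi], so walking along it disturbs no other image
    point. *)
Lemma simulated_path u v p : path e2 (phi u) (rcons p (phi v)) ->
  (forall w, phi w \notin p) -> simulated u v.
Proof.
move=> ep pN; suff [g gD [gu gN]] : exists2 g, g \in arc_semigroup e2 &
    g (phi u) = phi v /\ forall w, phi w != phi u -> g (phi w) = phi w.
  exists g => // w; rewrite arc_mapE; case: eqP => [->//|/eqP wu].
  by apply: gN; rewrite (inj_eq phi_inj).
elim: p (phi u) ep pN => [|y p IH] t /=.
  rewrite andbT => et _; exists (arc_map t (phi v)); first exact: arc_map_sg.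
  by rewrite arc_mapE eqxx; split=> // w /negbTE tw; rewrite arc_mapE tw.
case/andP=> et /IH{}IH pN.
have [w|g gD [gy gN]] := IH.
  by have := pN w; rewrite inE negb_or => /andP[].
exists (tcomp (arc_map t y) g); first by apply: tcomp_sg => //; apply: arc_map_sg.
rewrite tcompE arc_mapE eqxx; split=> // w /negbTE tw.
rewrite tcompE arc_mapE tw gN //.
by have := pN w; rewrite inE negb_or => /andP[].
Qed.

Let simulated_arc u v : e2 (phi u) (phi v) -> simulated u v.
Proof. by move=> euv; apply: (@simulated_path _ _ [::]) => //=; rewrite euv. Qed.

(** All arcs of the first path are mapped to arcs except those between the last vertex of [x1] and
    [b1], which are simulated along the surplus of [x2]. *)
Let simulated_chain i : 0 < size x1 -> i <= size x1 ->
  let z := a1 :: rcons x1 b1 in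
  simulated (nth a1 z i) (nth a1 z i.+1) /\ simulated (nth a1 z i.+1) (nth a1 z i).
Proof.
move=> x1_gt0; rewrite leq_eqVlt => lei z.
have phi_z l : l <= size x1 -> phi (nth a1 z l) = nth a2 (a2 :: rcons x2 b2) l.
  case: l => [|l] /= lt_l; first by apply: same_index; [exact: chain_start dec1|].
  by rewrite !nth_rcons lt_l (leq_trans lt_l le_x) phi_x.
have ep := chain_path dec2.
case/predU1P: lei => [->|lt_i]; last first.
  have ez : e2 (phi (nth a1 z i)) (phi (nth a1 z i.+1)).
    rewrite !phi_z // ?(ltnW lt_i) //; apply: (pathP a2 ep).
    by rewrite size_rcons; lia.
  by split; apply: simulated_arc; rewrite // sym2.
have -> : nth a1 z (size x1).+1 = b1 by rewrite /= nth_rcons ltnn eqxx.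
have phi_b : phi b1 = b2 by apply: same_index => //; exact: chain_end dec1.
have phi_y := phi_z _ (leqnn _); set y := nth _ _ _ in phi_y *.
have Ex2 : rcons x2 b2 = take (size x1).-1 x2 ++ phi y :: rcons (drop (size x1) x2) b2.
  rewrite phi_y -{1}(cat_take_drop (size x1).-1 x2) (drop_nth a2); last by lia.
  rewrite prednK // rcons_cat /=; congr (_ ++ _ :: _).
  by case: (size x1) x1_gt0 le_x => //= m _ lt_m; rewrite nth_rcons lt_m.
move: ep; rewrite Ex2 cat_path => /andP[_ /andP[_ ep]].
have dN w : phi w \notin drop (size x1) x2.
  have := chain_uniq dec2; rewrite -{1}(cat_take_drop (size x1) x2) catA cat_uniq.
  case/and3P=> _ /hasPn dN _; apply/negP => /dN/negP; apply.
  have := index_mem w (s1 ++ x1); rewrite (chain_all dec1) size_cat => lt_w.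
  have <- : nth a2 (s2 ++ take (size x1) x2) (index w (s1 ++ x1)) = phi w.
    rewrite /phi -{2}(cat_take_drop (size x1) x2) catA [RHS]nth_cat.
    by rewrite size_cat size_takel // -size_s lt_w.
  by apply: mem_nth; rewrite size_cat size_takel // -size_s.
split; first by apply: simulated_path dN; rewrite phi_b.
apply: (@simulated_path _ _ (rev (drop (size x1) x2))); last first.
  by move=> w; rewrite mem_rev.
have := rev_path e2 (phi y) (rcons (drop (size x1) x2) b2).
rewrite last_rcons belast_rcons rev_cons phi_b => ->.
by apply: sub_path ep => u v; rewrite sym2.
Qed.

(** By [chain_nbr], an arc that meets [x1] belongs to the path; an arc within [s1] is mapped to an
    arc, as the adjacency bits agree. *)
Lemma max_cycle_subdivision : max_cycle e1 <= max_cycle e2.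
Proof.
apply: (@max_cycle_simulation _ _ _ _ phi) => // u v euv.
have in_x i w : i < size x1 -> e1 (nth a1 x1 i) w ->
    simulated (nth a1 x1 i) w /\ simulated w (nth a1 x1 i).
  move=> lt_i ew; have x1_gt0 := leq_ltn_trans (leq0n i) lt_i.
  have Ei : nth a1 (a1 :: rcons x1 b1) i.+1 = nth a1 x1 i.
    by rewrite /= nth_rcons lt_i.
  have [] := simulated_chain x1_gt0 (ltnW lt_i).
  have [] := simulated_chain x1_gt0 lt_i; rewrite !Ei => s1i s2i s3i s4i.
  case: (chain_nbr dec1 lt_i ew) => -> //.
  suff -> : nth a1 (a1 :: x1) i = nth a1 (a1 :: rcons x1 b1) i by [].
  by case: i lt_i {ew Ei s1i s2i s3i s4i} => //= i lt_i; rewrite nth_rcons (ltnW lt_i).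
have := chain_all dec1 u; rewrite mem_cat => /orP[us|/(nthP a1)[i lt_i Ei]]; last first.
  by move: euv; rewrite -Ei => /(in_x _ _ lt_i)[].
have := chain_all dec1 v; rewrite mem_cat => /orP[vs|/(nthP a1)[i lt_i Ei]]; last first.
  by move: euv; rewrite sym1 -Ei => /(in_x _ _ lt_i)[].
by apply: simulated_arc; rewrite same_arc.
Qed.

End Subdivision.

(** * The table of answers *)

(** Quantifying over all graphs with the given description makes this a property of the bits and of
    [j] alone, downward closed in [j]. *)
Definition short_cycles k ba bb bm j : Prop :=
  forall n (e : rel 'I_n) s x a b, symmetric e -> chain_dec e s x a b ->
    position_bits s a = ba -> position_bits s b = bb -> adjacency_bits e s = bm ->
    size x <= j -> max_cycle e <= k.

Lemma short_cyclesP k n (e : rel 'I_n) s x a b :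
  symmetric e -> chain_dec e s x a b ->
  max_cycle e <= k <->
  short_cycles k (position_bits s a) (position_bits s b) (adjacency_bits e s) (size x).
Proof.
move=> e_sym dec; split=> [le_k n' e' s' x' a' b' sym' dec' Ea Eb Em le_x|]; last first.
  by apply; first exact: e_sym; first exact: dec.
exact: leq_trans (max_cycle_subdivision sym' e_sym dec' dec Ea Eb Em le_x) le_k.
Qed.

Lemma short_cycles_le k ba bb bm i j :
  i <= j -> short_cycles k ba bb bm j -> short_cycles k ba bb bm i.
Proof. by move=> le_ij H n e s x a b s1 d1 ? ? ? /leq_trans/(_ le_ij); apply: H d1 _ _ _. Qed.

(** By excluded middle, [P] either fails at some [T], and then from there on, or holds
    everywhere. *)
Lemma eventually_constant (P : nat -> Prop) : (forall i j, i <= j -> P j -> P i) ->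
  exists T, forall T', T <= T' -> forall j, P (minn j T') <-> P j.
Proof.
move=> Pdown; case: (classic (exists T, ~ P T)) => [[T NPT]|all_P].
  exists T => T' le_T j; have [le_j|/ltnW le_j] := leqP j T'; first by [].
  by split=> HP; case: NPT; apply: Pdown HP => //; apply: leq_trans le_j.
have {}all_P j : P j by apply: NNPP => NP; apply: all_P; exists j.
by exists 0.
Qed.

(** There are finitely many bit lists of length at most [L]; splitting by the first bit, their
    bounds are added up. *)
Lemma uniform_bound L (P : seq bool -> nat -> Prop) :
  (forall bs, exists T, forall T', T <= T' -> P bs T') ->
  exists T, forall bs, size bs <= L -> forall T', T <= T' -> P bs T'.
Proof.
elim: L P => [|L IH] P HP.
  by have [T HT] := HP [::]; exists T => -[].
have [T0 HT0] := HP [::].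
have [T1 HT1] := IH (fun bs => P (true :: bs)) (fun bs => HP _).
have [T2 HT2] := IH (fun bs => P (false :: bs)) (fun bs => HP _).
exists (T0 + T1 + T2) => -[|[] bs] sz T' le_T; [apply: HT0|apply: HT1|apply: HT2] => //; lia.
Qed.

(** [f] is chosen classically, but only its values at bit lists of bounded length and numbers up to
    [T] matter: a finite table, which a program can contain. *)
Lemma short_cycles_table k L :
  exists (T : nat) (f : seq bool -> seq bool -> seq bool -> nat -> bool),
  forall n (e : rel 'I_n) s x a b,
    symmetric e -> chain_dec e s x a b -> size s <= L ->
    f (position_bits s a) (position_bits s b) (adjacency_bits e s) (minn (size x) T) =
    (max_cycle e <= k).
Proof.
pose P ba bb bm T := forall j, short_cycles k ba bb bm (minn j T) <-> short_cycles k ba bb bm j.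
have [T HT] : exists T, forall ba, size ba <= L -> forall T', T <= T' ->
    forall bb, size bb <= L -> forall bm, size bm <= L * L -> P ba bb bm T'.
  apply: uniform_bound => ba.
  suff [T HT] : exists T, forall bb, size bb <= L -> forall T', T <= T' ->
      forall bm, size bm <= L * L -> P ba bb bm T'.
    by exists T => T' le_T bb sb; apply: HT.
  apply: uniform_bound => bb.
  suff [T HT] : exists T, forall bm, size bm <= L * L -> forall T', T <= T' -> P ba bb bm T'.
    by exists T => T' le_T bm sm; apply: HT.
  by apply: uniform_bound => bm; apply: eventually_constant => i j; apply: short_cycles_le.
exists T, (fun ba bb bm j =>
  if excluded_middle_informative (short_cycles k ba bb bm j) then true else false).
move=> n e s x a b e_sym dec sz; have EP := short_cyclesP k e_sym dec.
have sz_adj : size (adjacency_bits e s) <= L * L by rewrite size_allpairs leq_mul.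
have {HT}HT := HT _ _ T (leqnn T) _ _ _ sz_adj (size x).
case: excluded_middle_informative => H; apply/esym; last apply/negbTE/negP.
  by apply/EP/HT; rewrite ?size_map.
by move/EP/HT; rewrite !size_map => /(_ sz sz).
Qed.

(** * The input and the cost of programs *)

Fixpoint stored_list (inp : nat -> nat) (p : nat) (s : seq nat) : Prop :=
  if s is x :: s' then [/\ p != 0, inp p = x & stored_list inp (inp p.+1) s']
  else p = 0.

(** A nonempty prefix keeps the cells away from address 0, which marks the end of a list. *)
Lemma stored_list_cells pre s post : pre != [::] ->
  stored_list (nth 0 (pre ++ list_cells (size pre) s ++ post))
    (if nilp s then 0 else size pre) s.
Proof.
elim: s pre => [|x s IH] //= pre pre_nil; set q := if nilp s then _ else _.
have := IH (pre ++ [:: x; q]); rewrite size_cat addn2 -catA /= => IH'.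
rewrite !nth_cat ltnn ltnNge leqnSn /= subnn subSnn /=; split=> //.
  by rewrite size_eq0.
by apply: IH'; case: (pre).
Qed.

Lemma size_list_cells p s : size (list_cells p s) = (size s).*2.
Proof. by elim: s p => //= x s IH p; rewrite IH doubleS. Qed.

Lemma size_list_heads p ls : size (list_heads p ls) = size ls.
Proof. by elim: ls p => //= s ls IH p; rewrite IH. Qed.

Lemma stored_all_cells pre ls i : pre != [::] -> i < size ls ->
  stored_list (nth 0 (pre ++ all_cells (size pre) ls))
    (nth 0 (list_heads (size pre) ls) i) (nth [::] ls i).
Proof.
elim: ls pre i => [|s ls IH] //= pre [|i] pre_nil; first by move=> _; apply: stored_list_cells.
rewrite ltnS => /(IH (pre ++ list_cells (size pre) s)).
by rewrite size_cat size_list_cells -catA; apply; case: (pre) pre_nil.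
Qed.

Definition words p (ls : seq (seq nat)) := p + (sumn (map size ls)).*2.

Lemma list_cells_le B p s : p + (size s).*2 <= B -> all (leq^~ B) s ->
  all (leq^~ B) (list_cells p s).
Proof.
elim: s p => //= x s IH p le_B /andP[-> sB] /=.
by rewrite IH // ?andbT; [case: ifP => // _; lia|lia].
Qed.

Lemma list_heads_le B p ls : words p ls <= B -> all (leq^~ B) (list_heads p ls).
Proof.
rewrite /words; elim: ls p => //= s ls IH p le_B.
by rewrite IH ?andbT; [case: ifP => // _; lia|lia].
Qed.

Lemma all_cells_le B p ls : words p ls <= B -> all (all (leq^~ B)) ls ->
  all (leq^~ B) (all_cells p ls).
Proof.
rewrite /words; elim: ls p => //= s ls IH p le_B /andP[sB lsB].
by rewrite all_cat IH // ?list_cells_le //; lia.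
Qed.

Record graph_input n (e : rel 'I_n) (inp : nat -> nat) : Prop := GraphInput {
  input_size : inp 0 = n;
  input_adj : forall u : 'I_n, exists l : seq 'I_n,
    [/\ uniq l, l =i e u & stored_list inp (inp u.+1) [seq (v : 'I_n).+1 | v <- l]];
  input_le : forall a, inp a <= 4 * n ^ 2 }.

Lemma encode_graph n (e : rel 'I_n) adj :
  0 < n -> adjacency_list e adj -> graph_input e (encode adj).
Proof.
move=> n_gt0 adjP; rewrite /encode; set ls := map _ _.
have sz_ls : size ls = n by rewrite size_map size_enum_ord.
have nth_ls (u : 'I_n) : nth [::] ls u = [seq (v : 'I_n).+1 | v <- adj u].
  by rewrite (nth_map u) ?size_enum_ord // nth_ord_enum.
split=> // [u|a].
  have [ul lE] := adjP u; exists (adj u); split=> //.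
  have := @stored_all_cells (n :: list_heads n.+1 ls) ls u isT.
  rewrite /= size_list_heads sz_ls => /(_ (ltn_ord u)).
  by rewrite nth_ls nth_cat size_list_heads sz_ls ltn_ord.
(* There are [n] lists of at most [n] entries of two words each, so addresses are at most n + 1 +
   2n^2, hence at most 4n^2 for positive [n]. *)
have le_words : words n.+1 ls <= 4 * n ^ 2.
  suff : sumn (map size ls) <= n * n by rewrite /words -mulnn; nia.
  rewrite -[X in X * n]sz_ls; have : all (fun s => size s <= n) ls.
    apply/allP => s /mapP[u _ ->]; rewrite size_map.
    have [/card_uniqP <- _] := adjP u.
    by rewrite -[leqRHS]card_ord max_card.
  by elim: (ls) => //= s q IH /andP[le_s /IH]; rewrite mulSn; lia.
have le_all : all (leq^~ (4 * n ^ 2)) (n :: list_heads n.+1 ls ++ all_cells n.+1 ls).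
  rewrite /= all_cat list_heads_le //= all_cells_le // ?andbT.
    by rewrite -mulnn; nia.
  apply/allP => s /mapP[u _ ->]; apply/allP => x /mapP[v _ ->].
  by apply: leq_trans (ltn_ord v) _; rewrite -mulnn; nia.
have [lt_a|le_a] := ltnP a (size (n :: list_heads n.+1 ls ++ all_cells n.+1 ls)).
  exact: (allP le_all) (mem_nth _ lt_a).
by rewrite nth_default.
Qed.

(** * Total correctness with time bounds *)

Section Runs.

Variables (W : nat) (inp : nat -> nat).

Definition runs (c : cmd) (s : state) (T : nat) (Q : state -> Prop) :=
  exists t s', [/\ exec W inp c s t s', t <= T & Q s'].

Lemma runs_weaken c s T T' (Q Q' : state -> Prop) : T <= T' ->
  (forall s', Q s' -> Q' s') -> runs c s T Q -> runs c s T' Q'.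
Proof.
move=> le_T QQ' [t [s' [ex le_t Qs]]]; exists t, s'; split; auto.
exact: leq_trans le_T.
Qed.

Lemma runs_skip s T (Q : state -> Prop) : 0 < T -> Q s -> runs Skip s T Q.
Proof. by move=> T0 Qs; exists 1, s; split=> //; constructor. Qed.

Lemma runs_assign s i r T (Q : state -> Prop) : 0 < T -> eval_rhs inp s r < W ->
  Q (set_reg s i (eval_rhs inp s r)) -> runs (Assign i r) s T Q.
Proof.
by move=> T0 lt_W Qs; exists 1, (set_reg s i (eval_rhs inp s r)); split=> //; constructor.
Qed.

Lemma runs_store s i j T (Q : state -> Prop) : 0 < T ->
  Q (set_mem s (reg s i) (reg s j)) -> runs (Store i j) s T Q.
Proof.
by move=> T0 Qs; exists 1, (set_mem s (reg s i) (reg s j)); split=> //; constructor.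
Qed.

Lemma runs_seq T1 T2 c1 c2 s T Q : T1 + T2 <= T ->
  runs c1 s T1 (fun s' => runs c2 s' T2 Q) -> runs (Seq c1 c2) s T Q.
Proof.
move=> le_T [t1 [s1 [ex1 le1 [t2 [s2 [ex2 le2 Qs]]]]]]; exists (t1 + t2), s2.
by split=> //; [apply: exec_seq ex1 ex2|lia].
Qed.

Lemma runs_if i c1 c2 s T Q : 0 < T ->
  (reg s i != 0 -> runs c1 s T.-1 Q) -> (reg s i = 0 -> runs c2 s T.-1 Q) ->
  runs (If i c1 c2) s T Q.
Proof.
move=> T0 H1 H2; have [si|si] := eqVneq (reg s i) 0.
  have [t [s' [ex le_t Qs]]] := H2 si; exists t.+1, s'.
  by split=> //; [apply: exec_if_false|lia].
have [t [s' [ex le_t Qs]]] := H1 si; exists t.+1, s'.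
by split=> //; [apply: exec_if_true|lia].
Qed.

(** The index of the invariant bounds the number of remaining iterations. Each costs the body and
    one test, and the final test costs one more step. *)
Lemma runs_while (I : nat -> state -> Prop) m i c s T Q :
  (forall m s, I m s -> reg s i = 0 -> Q s) ->
  (forall m s, I m s -> reg s i != 0 ->
     0 < m /\ runs c s T (fun s' => I m.-1 s')) ->
  I m s -> runs (While i c) s (m * T.+1).+1 Q.
Proof.
move=> Iend Istep; elim: m s => [|m IH] s Is.
  have [si|si] := eqVneq (reg s i) 0.
    by exists 1, s; split=> //; [apply: exec_while_false|apply: Iend Is si].
  by have [] := Istep _ _ Is si.
have [si|si] := eqVneq (reg s i) 0.
  by exists 1, s; split=> //; [apply: exec_while_false|apply: Iend Is si].
have [_ [t1 [s1 [ex1 le1 /IH[t2 [s2 [ex2 le2 Qs]]]]]]] := Istep _ _ Is si.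
exists (t1 + t2).+1, s2; split=> //; first exact: exec_while_true ex1 ex2.
by rewrite mulSn; lia.
Qed.

Lemma runs_seq_assign s i r c T Q : 0 < T -> eval_rhs inp s r < W ->
  runs c (set_reg s i (eval_rhs inp s r)) T.-1 Q -> runs (Seq (Assign i r) c) s T Q.
Proof.
by move=> T0 lt_W H; apply: (@runs_seq 1 T.-1); [lia|apply: runs_assign].
Qed.

Lemma runs_seq_store s i j c T Q : 0 < T ->
  runs c (set_mem s (reg s i) (reg s j)) T.-1 Q -> runs (Seq (Store i j) c) s T Q.
Proof. by move=> T0 H; apply: (@runs_seq 1 T.-1); [lia|apply: runs_store]. Qed.

End Runs.

(** * Walking along vertices of degree two *)

Notation "c1 ;; c2" := (Seq c1 c2) (at level 61, right associativity).

Notation memory := Defs.mem.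

(* Register 1 holds n, register 2 the current mark, registers 3 and 4 the previous
   and the current vertex of a walk, register 5 the number of its interior
   vertices, register 6 the constant 0, register 7 the last test result, register 8
   the other end of the path, register 9 the number of unmarked vertices, register
   13 the constant 1; registers 10, 11, 12, 14, 15 are temporary.  The vertex v has
   its mark at address v of the work memory, and the unmarked vertices are listed
   from address n + 1 on. *)

(* At a vertex of degree two, register 10 receives the sum of the two neighbours, from
   which [walk] obtains the next vertex by subtracting the previous one. *)
Definition test : cmd :=
  Assign 11 (Inp 4);; Assign 12 (Inp 11);; Assign 11 (Add 11 13);;
  Assign 11 (Inp 11);; Assign 7 (Cst 0);;
  If 11
    (Assign 14 (Inp 11);; Assign 11 (Add 11 13);; Assign 11 (Inp 11);;
     If 11 Skip
       (Assign 10 (Add 12 14);; Assign 15 (Ld 4);; Assign 7 (Defs.Sub 2 15)))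
    Skip.

(** The start is marked too, so that a walk around a cycle stops on returning to it. Every later
    vertex is marked only when it is left. *)
Definition walk : cmd :=
  Store 3 2;; Assign 5 (Cst 0);; test;;
  While 7
    (Store 4 2;; Assign 10 (Defs.Sub 10 3);; Assign 3 (Add 4 6);;
     Assign 4 (Add 10 6);; Assign 5 (Add 5 13);; test).

Definition same_data (s s' : state) :=
  memory s' = memory s /\
  let rs := [:: 1; 2; 3; 4; 5; 6; 8; 9; 13] in map (reg s') rs = map (reg s) rs.

Ltac assign := apply: runs_seq_assign; rewrite /= /upd //=.

Lemma max_card_uniq n (s : seq 'I_n) : uniq s -> size s <= n.
Proof. by move/card_uniqP => <-; rewrite -[leqRHS]card_ord max_card. Qed.

Section Walk.

Variables (n : nat) (e : rel 'I_n) (inp : nat -> nat) (W K : nat).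
Hypotheses (e_irr : irreflexive e) (e_sym : symmetric e).
Hypothesis inpP : graph_input e inp.
Hypothesis W_big : 4 * n ^ 2 + K < W.
Hypothesis K_gt0 : 0 < K.

Lemma lt_inp a : inp a < W.
Proof. by have := input_le inpP a; lia. Qed.

Lemma lt_inpD1 a : inp a + 1 < W.
Proof. by have := input_le inpP a; lia. Qed.

Lemma lt_linear a : a <= 4 * n + K -> a < W.
Proof. by move=> le_a; apply: leq_ltn_trans W_big; nia. Qed.

(** At most two entries of the list and the pointer after them are read, so the cost does not depend
    on the degree. *)
Lemma runs_test s (cur w0 : 'I_n) (Q : state -> Prop) :
  e cur w0 -> reg s 13 = 1 -> reg s 4 = cur.+1 ->
  memory s cur.+1 <= reg s 2 <= K ->
  (forall s', same_data s s' ->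
    (reg s' 7 != 0) = (#|e cur| == 2) && (memory s cur.+1 < reg s 2) ->
    (forall v w, #|e cur| = 2 -> e cur v -> e cur w -> v != w ->
       reg s' 10 = v.+1 + w.+1) -> Q s') ->
  runs W inp test s 14 Q.
Proof.
move=> ew r13 r4 /andP[le_mem r2] HQ; have [l [ul lE lP]] := input_adj inpP cur.
have lew : w0 \in l by rewrite lE.
have szl : #|e cur| = size l by rewrite -(card_uniqP ul); apply: eq_card => w; rewrite lE.
rewrite /test; assign; first exact: lt_inp.
rewrite r4; case: l ul lE lP lew szl => [|x l] //= ul lE [p0 Ex xl] _ szl.
assign; first exact: lt_inp.
assign; first by rewrite r13 lt_inpD1.
assign; first exact: lt_inp.
assign; first by apply: lt_linear; lia.
rewrite r13 addn1.
case: l ul lE xl szl => [|y l] ul lE /= xl szl.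
  apply: runs_if => //=; rewrite /upd //= xl // => _.
  by apply: runs_skip => //; apply: HQ => //; rewrite szl.
case: xl => p1 Ey yl; apply: runs_if; rewrite /upd //=; last by move/eqP; rewrite (negbTE p1).
move=> _; assign; first exact: lt_inp.
assign; first by rewrite r13 lt_inpD1.
assign; first exact: lt_inp.
rewrite r13 addn1 Ex Ey.
case: l ul lE yl szl => [|z l] ul lE /= yl szl.
  apply: runs_if; rewrite /upd //= yl // => _.
  assign; first by apply: lt_linear; have := ltn_ord x; have := ltn_ord y; lia.
  assign; first by rewrite r4; apply: lt_linear; lia.
  apply: runs_assign; rewrite /= /upd //=; first by apply: lt_linear; lia.
  apply: HQ; rewrite /upd //=.
    by rewrite szl /= r4 subn_eq0 -ltnNge.
  move=> v w _; rewrite -![e cur _]lE !inE.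
  case/orP=> /eqP-> /orP[]/eqP->; rewrite ?eqxx // => _.
  by rewrite addnC.
case: yl => p2 _ _; apply: runs_if; rewrite /upd //=; last by move/eqP; rewrite (negbTE p2).
by move=> _; apply: runs_skip => //; apply: HQ => //; rewrite szl.
Qed.

(** [x] lists the interior of a walk from [a] to [cur], latest vertex first. The case [cur = a] of a
    closed walk is allowed. *)
Record walked (first : 'I_n) (x : seq 'I_n) (a cur : 'I_n) : Prop := Walked {
  walked_uniq : uniq (rcons x a);
  walked_path : path e cur (rcons x a);
  walked_nbr : forall i w, i < size x -> e (nth a x i) w ->
    w = nth a (cur :: x) i \/ w = nth a (rcons x a) i.+1;
  walked_deg : {in x, forall v, #|e v| = 2};
  walked_first : last cur x = first }.

Lemma walked_nil a cur : e a cur -> walked cur [::] a cur.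
Proof. by move=> eac; split=> //=; rewrite e_sym eac. Qed.

Lemma deg2_nbr v p q w :
  #|e v| = 2 -> e v p -> e v q -> p != q -> e v w -> w = p \/ w = q.
Proof.
move=> deg_v ep eq pq ew.
have E : #|[set p; q]| = #|e v| by rewrite cards2 pq deg_v.
have sub : [set p; q] \subset e v.
  by apply/subsetP => u; rewrite !inE => /orP[]/eqP->.
have := subset_cardP E sub w; rewrite !inE [w \in e v]ew.
by case/orP=> /eqP; [left|right].
Qed.

Lemma walked_cons first x a cur w : walked first x a cur ->
  #|e cur| = 2 -> cur \notin rcons x a -> e cur w -> w != head a x ->
  walked first (cur :: x) a w.
Proof.
move=> wx deg_cur curN ew wh; split.
- by rewrite rcons_cons cons_uniq curN (walked_uniq wx).
- by rewrite rcons_cons /= e_sym ew (walked_path wx).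
- move=> [|i] v /=; last by move=> /(walked_nbr wx); apply.
  move=> _ ev; have := walked_path wx; rewrite [rcons x a]headI /= => /andP[eh _].
  by apply: deg2_nbr ev; rewrite // -?nth0.
- by move=> v; rewrite inE => /predU1P[->//|/(walked_deg wx)].
- by rewrite /= (walked_first wx).
Qed.

Lemma deg2_other v p : #|e v| = 2 -> exists2 q, q != p & e v q.
Proof.
move=> deg_v; have [q /andP[eq qp]|no_q] := pickP [pred q | e v q & q != p].
  by exists q.
have : #|e v| <= #|pred1 p|.
  apply/subset_leq_card/subsetP => q eq.
  by have := no_q q; rewrite /= [e v q]eq /= => /negbFE.
by rewrite deg_v card1.
Qed.

Lemma walked_head first x a cur : walked first x a cur -> e cur (head a x).
Proof. by case=> _; rewrite headI /= => /andP[]. Qed.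

(** Interior vertices have no neighbours but those on the walk, and [cur] is adjacent to the head of
    [x]. If [cur] were in [x], it would be the head, a loop, or the next entry, which leaves the
    head with only one neighbour. *)
Lemma walked_stop first x a cur : walked first x a cur -> cur \notin x.
Proof.
move=> wx; apply/negP => /(nthP a)[i lt_i Ecur].
have uz := walked_uniq wx; have szz : size (rcons x a) = (size x).+1 by rewrite size_rcons.
have ehd : e (nth a x i) (nth a (rcons x a) 0).
  by rewrite Ecur nth0 headI /= (walked_head wx).
case: (walked_nbr wx lt_i ehd) => /eqP; last by rewrite nth_uniq ?szz // ltnS.
case: i lt_i Ecur ehd => [|i] lt_i Ecur ehd /=.
  by move=> /eqP E; rewrite E Ecur e_irr in ehd.
have -> : nth a x i = nth a (rcons x a) i by rewrite nth_rcons (ltnW lt_i).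
rewrite nth_uniq ?szz //; last by apply: leqW; apply: ltnW.
move=> /eqP i0; rewrite -{i}i0 in lt_i Ecur ehd *.
have x_gt0 : 0 < size x by apply: leq_ltn_trans lt_i.
have [q /negP qcur eq] := deg2_other cur (walked_deg wx (mem_nth a x_gt0)).
by apply: qcur; case: (walked_nbr wx x_gt0 eq) => -> /=; rewrite ?nth_rcons ?lt_i ?Ecur.
Qed.

Definition kept (s s' : state) :=
  let rs := [:: 1; 2; 6; 8; 9; 13] in map (reg s') rs = map (reg s) rs.

Lemma runs_walk s a c (Q : state -> Prop) :
  e a c -> reg s 13 = 1 -> reg s 6 = 0 -> reg s 3 = a.+1 -> reg s 4 = c.+1 ->
  reg s 2 <= K -> (forall u : 'I_n, memory s u.+1 < reg s 2) ->
  (forall s' x cur, walked c x a cur -> cur = a \/ #|e cur| <> 2 ->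
     reg s' 3 = (head a x).+1 -> reg s' 4 = cur.+1 -> reg s' 5 = size x -> kept s s' ->
     (forall u : 'I_n, memory s' u.+1 = if u \in rcons x a then reg s 2 else memory s u.+1) ->
     Q s') ->
  runs W inp walk s (21 * n + 20) Q.
Proof.
move=> eac r13 r6 r3 r4 r2 marks HQ.
(* The vertices of [rcons x a] are distinct, so [n - size x] bounds the remaining iterations. *)
pose I m st := exists x cur, [/\ m + size x = n, walked c x a cur, kept s st,
  [/\ reg st 3 = (head a x).+1, reg st 4 = cur.+1 & reg st 5 = size x] &
  [/\ forall u : 'I_n, memory st u.+1 = if u \in rcons x a then reg s 2 else memory s u.+1,
      (reg st 7 != 0) = (#|e cur| == 2) && (cur \notin rcons x a) &
      forall v w, #|e cur| = 2 -> e cur v -> e cur w -> v != w ->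
       reg st 10 = v.+1 + w.+1]].
have marked (t : seq 'I_n) (u : 'I_n) :
   ((if u \in t then reg s 2 else memory s u.+1) < reg s 2) = (u \notin t).
  by case: ifP; rewrite ?ltnn ?marks.
have marked_le (t : seq 'I_n) (u : 'I_n) :
   (if u \in t then reg s 2 else memory s u.+1) <= reg s 2.
  by case: ifP => // _; apply/ltnW/marks.
apply: (@runs_seq _ _ 1 (21 * n + 19)); [by lia|apply: runs_store => //].
apply: (@runs_seq _ _ 1 (21 * n + 18)); [by lia|apply: runs_assign => //=].
  by apply: lt_linear; lia.
apply: (@runs_seq _ _ 14 (21 * n + 1)); first by lia.
set s1 := set_reg _ _ _.
have m1 (u : 'I_n) : memory s1 u.+1 = if u \in [:: a] then reg s 2 else memory s u.+1.
  by rewrite /s1 /= /upd r3 inE eqSS.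
have eca : e c a by rewrite e_sym.
apply: (@runs_test s1 c a) => //; first by rewrite m1 marked_le.
move=> s2 [Em [E1 E2 E3 E4 E5 E6 E8 E9 E13]] f7 f10.
apply: (@runs_weaken _ _ _ _ (n * 20).+1 _ Q); [by lia|by []|].
apply: (@runs_while _ _ I); last first.
- exists [::], c; split=> //; first by rewrite addn0.
  + exact: walked_nil.
  + by rewrite /kept /= E1 E2 E6 E8 E9 E13.
  + by rewrite E3 E4 E5 /s1 /= /upd /= r3 r4.
  + split=> // [u|]; first by rewrite Em m1.
    by rewrite f7 m1 marked.
- move=> m st [x [cur [Em' wx kst [R3 R4 R5] [marks' r7 r10]]]].
  rewrite r7 => /andP[/eqP deg_cur curN].
  have := max_card_uniq (walked_uniq wx); rewrite size_rcons => le_n.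
  split; first by move: le_n Em'; clear; lia.
  have [w wh ew] := deg2_other (head a x) deg_cur.
  have wx' := walked_cons wx deg_cur curN ew wh.
  have eh := walked_head wx; rewrite eq_sym in wh.
  have {}r10 := r10 _ _ deg_cur eh ew wh.
  case: (kst) => K1 K2 K6 K8 K9 K13.
  apply: runs_seq_store; rewrite //=.
  assign; first by apply: lt_linear; have := ltn_ord w; lia.
  assign; first by rewrite R4 K6 r6; apply: lt_linear; have := ltn_ord cur; lia.
  assign; first by rewrite K6 r6 r10 R3; apply: lt_linear; have := ltn_ord w; lia.
  assign; first by rewrite K13 r13 R5; apply: lt_linear; lia.
  set st1 := set_reg _ _ _.
  have m1' (u : 'I_n) : memory st1 u.+1 =
      if u \in rcons (cur :: x) a then reg s 2 else memory s u.+1.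
    rewrite /st1 /= /upd R4 K2 inE eqSS marks'.
    by rewrite -[_ == _ :> nat]/(u == cur); case: eqP.
  have ewc : e w cur by rewrite e_sym.
  have R4' : reg st1 4 = w.+1 by rewrite /st1 /= /upd /= r10 R3 K6 r6; clear; lia.
  have R2' : reg st1 2 = reg s 2 by rewrite -K2.
  apply: (@runs_test st1 w cur) => //.
  - by rewrite /st1 /= /upd /= K13.
  - by rewrite m1' R2' marked_le.
  move=> s' [Ems [F1 F2 F3 F4 F5 F6 F8 F9 F13]] f7' f10'.
  exists (cur :: x), w; split=> //.
  - by rewrite /= addnS -addSn prednK //; move: le_n Em'; clear; lia.
  - by rewrite /kept /= F1 F2 F6 F8 F9 F13 /st1 /= /upd /= K1 K2 K6 K8 K9 K13.
  - split; [|by rewrite F4|].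
      by rewrite F3 /st1 /= /upd /= R4 K6 r6 addn0.
    by rewrite F5 /st1 /= /upd /= R5 K13 r13 addn1.
  - split=> // [u|]; first by rewrite Ems m1'.
    by rewrite f7' m1' R2' marked.
move=> m st [x [cur [Em' wx kst [R3 R4 R5] [marks' r7 r10]]]] r70.
apply: (HQ st x cur) => //.
move: r7; rewrite r70 eqxx /= => /esym/negbT.
rewrite negb_and negbK => /orP[/eqP|]; first by right.
(* A marked stopping vertex must be [a], as it is not in [x]. *)
by rewrite mem_rcons inE (negbTE (walked_stop wx)) orbF => /eqP; left.
Qed.

End Walk.

(** * Collecting the unmarked vertices *)

Definition scan : cmd :=
  Assign 9 (Cst 0);; Assign 10 (Add 1 6);;
  While 10
    (Assign 15 (Ld 10);; Assign 15 (Defs.Sub 2 15);;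
     If 15 (Assign 9 (Add 9 13);; Assign 11 (Add 9 1);; Store 11 10) Skip;;
     Assign 10 (Defs.Sub 10 13)).

(* The marks of successive walks increase, so that old marks need not be erased. *)
Definition trial (v : nat) : cmd :=
  Assign 2 (Cst v.*2);; Assign 3 (Cst v);; Assign 11 (Inp 3);;
  Assign 4 (Inp 11);; walk;;
  Assign 8 (Add 4 6);; Assign 4 (Add 3 6);; Assign 3 (Add 8 6);;
  Assign 2 (Cst v.*2.+1);; walk;; Store 8 6;; scan.

Section Trial.

Variables (n : nat) (e : rel 'I_n) (inp : nat -> nat) (W K : nat).
Hypotheses (e_irr : irreflexive e) (e_sym : symmetric e).
Hypothesis inpP : graph_input e inp.
Hypothesis W_big : 4 * n ^ 2 + K < W.
Hypothesis K_gt0 : 0 < K.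

Definition kept_scan (s s' : state) :=
  let rs := [:: 1; 4; 5; 6; 8; 13] in map (reg s') rs = map (reg s) rs.

Definition stored (s : state) (ss : seq 'I_n) :=
  forall p, p < size ss -> memory s (p.+1 + n) = nth 0 [seq u.+1 | u : 'I_n <- ss] p.

Lemma runs_scan s (x : seq 'I_n) (Q : state -> Prop) :
  reg s 1 = n -> reg s 6 = 0 -> reg s 13 = 1 -> reg s 2 <= K ->
  (forall u : 'I_n, memory s u.+1 <= reg s 2) ->
  (forall u : 'I_n, (memory s u.+1 < reg s 2) = (u \notin x)) ->
  (forall s' (ss : seq 'I_n), uniq ss -> (forall u, (u \in ss) = (u \notin x)) ->
     reg s' 9 = size ss -> stored s' ss -> kept_scan s s' ->
     (forall u : 'I_n, memory s' u.+1 = memory s u.+1) -> Q s') ->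
  runs W inp scan s (11 * n + 3) Q.
Proof.
move=> r1 r6 r13 r2 le_marks marks HQ.
(* Vertices are examined from [n] downwards, and the list is written above address [n], so the marks
   survive. *)
pose I m st := exists ss : seq 'I_n, [/\ reg st 10 = m /\ m <= n,
  uniq ss /\ (forall u : 'I_n, (u \in ss) = (m <= u) && (u \notin x)),
  reg st 9 = size ss /\ stored st ss, kept_scan s st /\ reg st 2 = reg s 2 &
  forall u : 'I_n, memory st u.+1 = memory s u.+1].
apply: (@runs_seq _ _ 1 (11 * n + 2)); [by lia|apply: runs_assign => //=].
  by apply: (lt_linear W_big K_gt0); lia.
apply: (@runs_seq _ _ 1 (11 * n + 1)); [by lia|apply: runs_assign => //=].
  by rewrite /upd /= r1 r6; apply: (lt_linear W_big K_gt0); lia.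
rewrite /upd /= r1 r6 addn0.
apply: (@runs_weaken _ _ _ _ (n * 11).+1 _ Q); [by lia|by []|].
apply: (@runs_while _ _ I); last first.
- exists [::]; split=> //; split=> // u.
  by rewrite in_nil; have := ltn_ord u; lia.
- move=> m st [ss [[R10 le_m] [uss ssE] [R9 st_ss] [kst R2] mst]].
  rewrite R10 -lt0n => m_gt0; split=> //.
  have lt_m : m.-1 < n by lia.
  set u := Ordinal lt_m; have Eu : u.+1 = m by rewrite /= prednK.
  case: (kst) => K1 K4 K5 K6 K8 K13.
  assign; first by rewrite R10 -Eu mst; apply: (lt_linear W_big K_gt0); have := le_marks u; lia.
  assign; first by rewrite R2; apply: (lt_linear W_big K_gt0); lia.
  rewrite R10 R2 -Eu mst.
  have uNss : u \notin ss by rewrite ssE /=; lia.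
  have le_ss : (size ss).+1 <= n.
    by have /max_card_uniq : uniq (u :: ss) by rewrite /= uNss.
  apply: (@runs_seq _ _ 7 1) => //.
  have mu : (memory s m.-1.+1 < reg s 2) = (u \notin x) by rewrite -marks.
  apply: runs_if; rewrite /= /upd //=; last first.
    move/eqP; rewrite subn_eq0 leqNgt mu negbK => ux.
    apply: runs_skip => //; apply: runs_assign; rewrite /= /upd //=.
      by rewrite R10; apply: (lt_linear W_big K_gt0); lia.
    exists ss; split; rewrite /= /upd /=; [split|split|split|split|] => //.
    + by rewrite R10 K13 r13; lia.
    + by lia.
    + move=> w; rewrite ssE; have [->|wu] := eqVneq w u; first by rewrite ux !andbF.
      by congr (_ && _); move: wu; rewrite -val_eqE /=; lia.
  rewrite -lt0n subn_gt0 mu => ux.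
  assign; first by rewrite R9 K13 r13; apply: (lt_linear W_big K_gt0); lia.
  assign; first by rewrite R9 K13 r13 K1 r1; apply: (lt_linear W_big K_gt0); lia.
  apply: runs_store => //; apply: runs_assign; rewrite /= /upd //=.
    by rewrite R10; apply: (lt_linear W_big K_gt0); lia.
  rewrite R9 K13 r13 K1 r1 R10 addn1 subn1.
  exists (rcons ss u); rewrite size_rcons; split; rewrite /= /upd /=;
    [split|split|split|split|] => //.
  + by lia.
  + by rewrite rcons_uniq uNss.
  + move=> w; rewrite mem_rcons inE ssE; have [->|wu] := eqVneq w u; first by rewrite ux leqnn.
    by congr (_ && _); move: wu; rewrite -val_eqE /=; lia.
  + move=> p; rewrite size_rcons ltnS leq_eqVlt map_rcons nth_rcons size_map /= /upd /=.
    case/predU1P=> [->|lt_p]; first by rewrite ltnn !eqxx Eu.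
    by rewrite lt_p eqn_add2r eqSS (ltn_eqF lt_p) st_ss.
  + by move=> w; rewrite ifN // neq_ltn; have := ltn_ord w; lia.
move=> m st [ss [[R10 _] [uss ssE] [R9 st_ss] [kst _] mst]] m0; rewrite -R10 m0 in ssE.
exact: (HQ st ss).
Qed.

(** The start may be in the middle of a chain. The first walk finds an end [z]; the second leaves
    [z] through the vertex visited just before it, with a larger mark, and so can traverse the whole
    chain. *)
Lemma runs_trial s (v0 w0 : 'I_n) v (Q : state -> Prop) : v = v0.+1 -> e v0 w0 ->
  reg s 1 = n -> reg s 6 = 0 -> reg s 13 = 1 -> v.*2.+1 <= K ->
  (forall u : 'I_n, memory s u.+1 < v.*2) ->
  (forall s' first x1 z x b ss,
     walked e first x1 v0 z -> z = v0 \/ #|e z| <> 2 ->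
     walked e (head v0 x1) x z b -> b = z \/ #|e b| <> 2 ->
     uniq ss -> (forall u, (u \in ss) = (u \notin x)) -> stored s' ss ->
     [/\ reg s' 1 = n, reg s' 6 = 0 & reg s' 13 = 1] ->
     [/\ reg s' 4 = b.+1, reg s' 5 = size x, reg s' 8 = z.+1 & reg s' 9 = size ss] ->
     (forall u : 'I_n, memory s' u.+1 < (v.+1).*2) -> Q s') ->
  runs W inp (trial v) s (100 * n + 100) Q.
Proof.
move=> Ev ew r1 r6 r13 le_v marks HQ.
have lt := lt_linear W_big K_gt0.
have [l [ul lE lP]] := input_adj inpP v0.
case: l ul lE lP => [|c l] ul lE /=; first by move: (lE w0); rewrite in_nil [w0 \in _]ew.
case=> p0 Ec _.
have evc : e v0 c by have := lE c; rewrite mem_head => /esym.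
apply: (@runs_seq _ _ 1 (100 * n + 99)); [by lia|apply: runs_assign => //=].
  by apply: lt; lia.
apply: (@runs_seq _ _ 1 (100 * n + 98)); [by lia|apply: runs_assign => //=].
  by apply: lt; lia.
apply: (@runs_seq _ _ 1 (100 * n + 97)); [by lia|apply: runs_assign => //=].
  exact: (lt_inp inpP W_big K_gt0).
apply: (@runs_seq _ _ 1 (100 * n + 96)); [by lia|apply: runs_assign => //=].
  exact: (lt_inp inpP W_big K_gt0).
apply: (@runs_seq _ _ (21 * n + 20) (79 * n + 76)); first by lia.
apply: (runs_walk e_irr e_sym inpP W_big K_gt0 (c := c) (a := v0)) => //.
- by rewrite /= /upd /= Ev Ec.
- by rewrite /= /upd /=; lia.
move=> s1 x1 z w1 stop1 R3 R4 R5 [R1 R2 R6 R8 R9 R13] marks1.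
rewrite /= /upd /= in R1 R2 R6 R8 R9 R13 marks1.
have lt_z := ltn_ord z; have lt_hd := ltn_ord (head v0 x1).
apply: (@runs_seq _ _ 1 (79 * n + 75)); [by lia|apply: runs_assign => //=].
  by apply: lt; lia.
apply: (@runs_seq _ _ 1 (79 * n + 74)); [by lia|apply: runs_assign => //=].
  by rewrite /upd /=; apply: lt; lia.
apply: (@runs_seq _ _ 1 (79 * n + 73)); [by lia|apply: runs_assign => //=].
  by rewrite /upd /=; apply: lt; lia.
apply: (@runs_seq _ _ 1 (79 * n + 72)); [by lia|apply: runs_assign => //=].
  by apply: lt; lia.
apply: (@runs_seq _ _ (21 * n + 20) (58 * n + 52)); first by lia.
apply: (runs_walk e_irr e_sym inpP W_big K_gt0 (c := head v0 x1) (a := z)) => //.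
- exact: walked_head w1.
- by rewrite /= /upd /= R13.
- by rewrite /= /upd /= R6.
- by rewrite /= /upd /= R4 R6 r6; lia.
- by rewrite /= /upd /= R3 R6 r6; lia.
- move=> u; rewrite /= /upd /= marks1; case: ifP => // _.
  by have := marks u; lia.
move=> s2 x b w2 stop2 S3 S4 S5 [S1 S2 S6 S8 S9 S13] marks2.
rewrite /= /upd /= in S1 S2 S6 S8 S9 S13 marks2.
(* The second walk marked its start [z]; erasing this mark leaves exactly [x] marked. *)
apply: (@runs_seq _ _ 1 (58 * n + 51)); [by lia|apply: runs_store => //=].
apply: (@runs_weaken _ _ _ _ (11 * n + 3) _ Q); [by lia|by []|].
have Z : reg s2 8 = z.+1 by rewrite S8 R4 R6 r6 addn0.
have marks3 (u : 'I_n) : upd (memory s2) (reg s2 8) (reg s2 6) u.+1 =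
   if u == z then 0 else if u \in x then v.*2.+1 else memory s1 u.+1.
  by rewrite /upd Z eqSS S6 R6 r6 marks2 mem_rcons inE val_eqE; case: eqP.
have lt_s1 (u : 'I_n) : memory s1 u.+1 < v.*2.+1.
  by rewrite marks1; case: ifP => // _; have := marks u; lia.
have zNx : z \notin x by have := walked_uniq w2; rewrite rcons_uniq => /andP[].
apply: (@runs_scan _ x) => //=.
- by rewrite S1 R1.
- by rewrite S6 R6.
- by rewrite S13 R13.
- by rewrite S2.
- move=> u; rewrite marks3 S2; case: ifP => // _; case: ifP => // _.
  exact/ltnW.
- move=> u; rewrite marks3 S2; case: eqP => [->|_]; first by rewrite zNx.
  by case: ifP; rewrite ?ltnn ?lt_s1.
move=> s' ss uss ssE r9 st_ss [T1 T4 T5 T6 T8 T13] mst.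
rewrite /= in T1 T4 T5 T6 T8 T13.
apply: (HQ s' c x1 z x b ss) => //.
- by rewrite T1 S1 R1 T6 S6 R6 T13 S13 R13.
- by rewrite T4 T5 T8 Z S4 S5 r9.
move=> u; rewrite mst /= marks3; case: ifP => [_|_]; first by lia.
by case: ifP => _; [lia|have := lt_s1 u; lia].
Qed.

End Trial.

(** * Reading the table *)

(* The continuation [k] is chosen by the answers, which are read in register 7: the
   program branches on them and thus knows them statically at its leaves. *)
Fixpoint ask (qs : seq cmd) (k : seq bool -> cmd) : cmd :=
  if qs is q :: qs' then
    q;; If 7 (ask qs' (fun bs => k (true :: bs))) (ask qs' (fun bs => k (false :: bs)))
  else k [::].

Definition ask_lt (r i : nat) : cmd := Assign 7 (Cst i);; Assign 7 (Defs.Sub r 7).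

Definition ask_pos (r p : nat) : cmd :=
  Assign 10 (Cst p.+1);; Assign 10 (Add 10 1);; Assign 10 (Ld 10);;
  Assign 11 (Defs.Sub 10 r);; Assign 12 (Defs.Sub r 10);; Assign 11 (Add 11 12);;
  If 11 (Assign 7 (Cst 0)) (Assign 7 (Cst 1)).

Definition ask_adj (pq : nat * nat) : cmd :=
  Assign 12 (Cst pq.1.+1);; Assign 12 (Add 12 1);; Assign 12 (Ld 12);;
  Assign 12 (Inp 12);;
  Assign 11 (Cst pq.2.+1);; Assign 11 (Add 11 1);; Assign 11 (Ld 11);;
  Assign 7 (Cst 0);;
  While 12
    (Assign 14 (Inp 12);; Assign 15 (Defs.Sub 14 11);; Assign 14 (Defs.Sub 11 14);;
     Assign 15 (Add 15 14);; If 15 Skip (Assign 7 (Cst 1));;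
     Assign 12 (Add 12 13);; Assign 12 (Inp 12)).

Definition decide N T (f : seq bool -> seq bool -> seq bool -> nat -> bool) : cmd :=
  ask [seq ask_lt 9 i | i <- iota 0 N] (fun bn =>
  let ps := iota 0 (count id bn) in
  ask [seq ask_pos 4 p | p <- ps] (fun ba =>
  ask [seq ask_pos 8 p | p <- ps] (fun bb =>
  ask [seq ask_adj pq | pq <- [seq (p, q) | p <- ps, q <- ps]] (fun bm =>
  ask [seq ask_lt 5 i | i <- iota 0 T] (fun bj =>
  Assign 0 (Cst (f ba bb bm (count id bj)))))))).

Lemma count_ltn_iota m N : count id [seq i < m | i <- iota 0 N] = minn m N.
Proof.
elim: N => [|N IH]; first by rewrite minn0.
rewrite -addn1 iotaD map_cat count_cat IH /= add0n addn0; lia.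
Qed.

Section Ask.

Variables (n : nat) (e : rel 'I_n) (inp : nat -> nat) (W K : nat).
Hypothesis inpP : graph_input e inp.
Hypothesis W_big : 4 * n ^ 2 + K < W.
Hypothesis K_gt0 : 0 < K.

Let lt := lt_linear W_big K_gt0.

Definition answers (I : state -> Prop) q T b :=
  forall s, I s -> runs W inp q s T (fun s' => I s' /\ (reg s' 7 != 0) = b).

Lemma runs_ask (A : eqType) (q : A -> cmd) (b : A -> bool) l m k T T' I Q :
  size l = m -> {in l, forall i, answers I (q i) T (b i)} ->
  (forall s, I s -> runs W inp (k (map b l)) s T' Q) ->
  forall s, I s -> runs W inp (ask (map q l) k) s (m * T.+1 + T') Q.
Proof.
move=> <-; elim: l k => [|i l IH] k Hq Hk s Is /=; first exact: Hk.
apply: (@runs_seq _ _ T (size l * T.+1 + T').+1); first by rewrite mulSn; lia.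
apply: runs_weaken (leqnn T) _ (Hq i (mem_head _ _) s Is) => s1 [Is1 Es1].
have {}Hq : {in l, forall i, answers I (q i) T (b i)}.
  by move=> j jl; apply: Hq; rewrite inE jl orbT.
by apply: runs_if => //= [|/eqP]; [|rewrite -[_ == _]negbK]; rewrite Es1 => Ebi;
  apply: IH => // s2 Is2; have := Hk s2 Is2; rewrite /= ?(negbTE Ebi) ?Ebi.
Qed.

Variables (ss : seq 'I_n) (a b : 'I_n) (len : nat).
Hypothesis ss_uniq : uniq ss.
Hypothesis len_le : len <= n.

Definition ready (s : state) :=
  [/\ reg s 1 = n, reg s 13 = 1,
      reg s 4 = a.+1 /\ reg s 8 = b.+1,
      reg s 5 = len /\ reg s 9 = size ss & stored s ss].

Let le_ss : size ss <= n. Proof. exact: max_card_uniq. Qed.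

Let ready_set_reg s i x : i \in [:: 7; 10; 11; 12; 14; 15] -> ready s -> ready (set_reg s i x).
Proof.
move=> ii [r1 r13 [r4 r8] [r5 r9] st].
have ne j : j \in [:: 1; 4; 5; 8; 9; 13] -> (j == i) = false.
  by move: ii; rewrite !inE => Hi Hj; apply/negP => /eqP E; subst j; lia.
by split; rewrite /= /upd ?ne //; split; rewrite /= /upd ?ne.
Qed.

Lemma answers_lt r i m T : i <= K -> m <= n -> (forall s, ready s -> reg s r = m) ->
  r != 7 -> 1 < T -> answers ready (ask_lt r i) T (i < m).
Proof.
move=> le_i le_m rm r7 T1 s rs; have Er := rm s rs.
assign; [by lia|by apply: lt; lia|].
apply: runs_assign; rewrite /= /upd /= ?(negbTE r7) ?Er; [by lia|by apply: lt; lia|].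
split; last by rewrite -lt0n subn_gt0.
by do 2 apply: ready_set_reg => //.
Qed.

Let stored_nth s p : ready s -> p < size ss -> memory s (p.+1 + n) = (nth a ss p).+1.
Proof. by case=> _ _ _ _ st lt_p; rewrite st // (nth_map a). Qed.

Lemma answers_pos r p (c : 'I_n) T : 
  p <= K -> p < size ss -> (forall s, ready s -> reg s r = c.+1) ->
  r \notin [:: 7; 10; 11; 12] -> 7 < T -> answers ready (ask_pos r p) T (nth a ss p == c).
Proof.
move=> le_p lt_p rc; rewrite !inE !negb_or => /and4P[r7 r10 r11 r12] T7 s rs; have Er := rc s rs.
have Em := stored_nth rs lt_p; have [r1 _ _ _ _] := rs.
have := ltn_ord (nth a ss p); have := ltn_ord c => lt_c lt_nth.
apply: (@runs_weaken _ _ _ _ 8 _ _) (T7) (fun _ => id) _.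
assign; first by apply: lt; lia.
assign; first by rewrite r1; apply: lt; lia.
assign; first by rewrite r1 Em; apply: lt; lia.
rewrite r1 Em.
assign; first by rewrite (negbTE r10); apply: lt; lia.
assign; first by rewrite (negbTE r11) (negbTE r10) Er; apply: lt; lia.
rewrite (negbTE r11) (negbTE r10) Er.
assign; first by apply: lt; lia.
have Ec : ((nth a ss p).+1 - c.+1 + (c.+1 - (nth a ss p).+1) == 0) = (nth a ss p == c).
  by rewrite -val_eqE /=; lia.
apply: runs_if; rewrite /= /upd //=.
  rewrite Ec => /negbTE nc; apply: runs_assign => /=; [by []|by apply: lt; lia|].
  by rewrite nc; split=> //; do 7 apply: ready_set_reg => //.
move/eqP; rewrite Ec => ->; apply: runs_assign => /=; [by []|by apply: lt; lia|].
by split=> //; do 7 apply: ready_set_reg => //.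
Qed.

Lemma answers_adj p q T : p <= K -> q <= K -> p < size ss -> q < size ss ->
  9 * n + 9 <= T -> answers ready (ask_adj (p, q)) T (e (nth a ss p) (nth a ss q)).
Proof.
move=> le_p le_q lt_p lt_q le_T s rs.
have Ep := stored_nth rs lt_p; have Eq := stored_nth rs lt_q; have [r1 r13 _ _ _] := rs.
set u := nth a ss p in Ep *; set w := nth a ss q in Eq *.
have lt_u := ltn_ord u; have lt_w := ltn_ord w.
have [l [ul lE lP]] := input_adj inpP u.
apply: (@runs_weaken _ _ _ _ (9 * n + 1).+4.+4) => //; [by lia|by move=> s'; apply: id|].
rewrite /ask_adj.
assign; first by apply: lt; lia.
assign; first by rewrite r1; apply: lt; lia.
assign; first by rewrite r1 Ep; apply: lt; lia.
assign; first exact: (lt_inp inpP W_big K_gt0).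
assign; first by apply: lt; lia.
assign; first by rewrite r1; apply: lt; lia.
assign; first by rewrite r1 Eq; apply: lt; lia.
assign; first by apply: lt; lia.
rewrite r1 Ep Eq.
(* [l1] has been compared with [w]. The bound on register 12 excludes an overflow when the pointer
   is advanced. *)
pose I m st := exists l1 l2, [/\ l = l1 ++ l2, m = size l2,
  stored_list inp (reg st 12) [seq v.+1 | v : 'I_n <- l2], ready st &
  [/\ reg st 11 = w.+1, (reg st 7 != 0) = (w \in l1) & reg st 12 + 1 < W]].
have le_l := max_card_uniq ul.
apply: (@runs_weaken _ _ _ _ (size l * 9).+1); [by lia|by move=> s'; apply: id|].
apply: (@runs_while _ _ I); last first.
- exists [::], l; split=> //=; rewrite /upd //=.
  by split=> //; apply: (lt_inpD1 inpP W_big K_gt0).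
- move=> m st [l1 [l2 [El -> sl2 rst [R11 R7 lt12]]]] R12.
  case: l2 El sl2 => [|v l2] El /=; first by move=> E0; rewrite E0 in R12.
  case=> p0 Ev sl2; split=> //; have [_ R13 _ _ _] := rst.
  have lt_v := ltn_ord v.
  assign; first exact: (lt_inp inpP W_big K_gt0).
  assign; first by rewrite R11 Ev; apply: lt; lia.
  assign; first by rewrite R11 Ev; apply: lt; lia.
  assign; first by rewrite R11 Ev; apply: lt; lia.
  have Evw : (v.+1 - w.+1 + (w.+1 - v.+1) == 0) = (w == v) by rewrite -val_eqE /=; lia.
  apply: (@runs_seq _ _ 2 2) => //.
  have El' : l = rcons l1 v ++ l2 by rewrite cat_rcons.
  apply: runs_if; rewrite /= /upd //= R11 Ev.
    rewrite Evw => /negbTE wv; apply: runs_skip => //.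
    assign; first by rewrite R13; exact: lt12.
    apply: runs_assign; rewrite /= /upd //=; first exact: (lt_inp inpP W_big K_gt0).
    exists (rcons l1 v), l2; split; rewrite /= /upd //= ?R13 ?addn1 //.
    by split; rewrite ?mem_rcons ?inE ?wv ?R11 // -addn1; apply: (lt_inpD1 inpP W_big K_gt0).
  move/eqP; rewrite Evw => wv; apply: runs_assign => /=; [by []|by apply: lt; lia|].
  assign; first by rewrite R13; exact: lt12.
  apply: runs_assign; rewrite /= /upd //=; first exact: (lt_inp inpP W_big K_gt0).
  exists (rcons l1 v), l2; split; rewrite /= /upd //= ?R13 ?addn1 //.
  by split; rewrite ?mem_rcons ?inE ?wv ?R11 // -addn1; apply: (lt_inpD1 inpP W_big K_gt0).
move=> m st [l1 [[|v l2] [El _ sl2 rst [R11 R7 _]]]] R12; last first.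
  by case: sl2; rewrite R12.
by split=> //; rewrite R7 -[e u w]lE El cats0.
Qed.

Lemma runs_decide N T f s (Q : state -> Prop) : ready s ->
  size ss <= N -> N <= K -> T <= K ->
  (forall s', (reg s' 0 != 0) =
     f (position_bits ss a) (position_bits ss b) (adjacency_bits e ss) (minn len T) -> Q s') ->
  runs W inp (decide N T f) s ((3 * N + N * N + T) * (9 * n + 10) + 1) Q.
Proof.
move=> rs le_N N_le T_le HQ; have n_gt0 : 0 < n by apply: leq_ltn_trans (ltn_ord a).
(* An adjacency question, the most expensive kind, may scan a list of [n] entries. *)
set D := 9 * n + 9; have D9 : 9 < D by rewrite /D; lia.
set c := size ss.
apply: (@runs_weaken _ _ _ _
  (N * D.+1 + (c * D.+1 + (c * D.+1 + (c * c * D.+1 + (T * D.+1 + 1)))))).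
- have cc : c * c <= N * N by rewrite leq_mul.
  by rewrite -addnS -/D !addnA leq_add2r -!mulnDl leq_mul2r; lia.
- by move=> s'; apply: id.
rewrite /decide.
apply: (@runs_ask _ (ask_lt 9) (fun i => i < size ss)
  _ _ _ D _ ready Q (size_iota _ _) _ _ s rs).
  move=> i; rewrite mem_iota add0n => lt_i; apply: answers_lt => //; [by lia| |by lia].
  by move=> st [_ _ _ [_ ->]].
rewrite count_ltn_iota (minn_idPl le_N) -/c => s1 rs1 /=.
have bitsE (v : 'I_n) : position_bits ss v = [seq nth a ss p == v | p <- iota 0 c].
  by rewrite /position_bits -{1}(mkseq_nth a ss) /mkseq -map_comp.
apply: (@runs_ask _ (ask_pos 4) (fun p => nth a ss p == a)
  _ _ _ D _ ready Q (size_iota _ _) _ _ s1 rs1).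
  move=> p; rewrite mem_iota add0n => lt_p; apply: answers_pos => //; [by lia| |by lia].
  by move=> st [_ _ [->]].
move=> s2 rs2.
apply: (@runs_ask _ (ask_pos 8) (fun p => nth a ss p == b)
  _ _ _ D _ ready Q (size_iota _ _) _ _ s2 rs2).
  move=> p; rewrite mem_iota add0n => lt_p; apply: answers_pos => //; [by lia| |by lia].
  by move=> st [_ _ [_ ->]].
move=> s3 rs3; set pqs := [seq (p, q) | p <- _, q <- _].
have szp : size pqs = c * c by rewrite size_allpairs size_iota.
apply: (@runs_ask _ ask_adj (fun pq => e (nth a ss pq.1) (nth a ss pq.2))
  _ _ _ D _ ready Q szp _ _ s3 rs3).
  move=> _ /allpairsP[[p q] [/= lt_p lt_q ->]].
  by move: lt_p lt_q; rewrite !mem_iota !add0n => lt_p lt_q; apply: answers_adj => //; lia.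
move=> s4 rs4.
apply: (@runs_ask _ (ask_lt 5) (fun i => i < len)
  _ _ _ D _ ready Q (size_iota _ _) _ _ s4 rs4).
  move=> i; rewrite mem_iota add0n => lt_i; apply: answers_lt => //; [by lia| |by lia].
  by move=> st [_ _ _ [->]].
move=> s5 rs5; rewrite count_ltn_iota -!bitsE.
have -> : [seq e (nth a ss pq.1) (nth a ss pq.2) | pq <- pqs] = adjacency_bits e ss.
  rewrite /adjacency_bits -{3 4}(mkseq_nth a ss) /mkseq allpairs_mapl allpairs_mapr.
  by rewrite /pqs map_allpairs.
apply: runs_assign => //=; first by apply: lt; case: (f _ _ _ _); lia.
by apply: HQ; rewrite /= /upd /=; case: (f _ _ _ _).
Qed.

End Ask.

(** * The algorithm *)

Section Closure.

Variables (n : nat) (e : rel 'I_n).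
Hypotheses (e_irr : irreflexive e) (e_sym : symmetric e).

Lemma connect_closed (X : seq 'I_n) u v : (forall p q, p \in X -> e p q -> q \in X) ->
  u \in X -> connect e u v -> v \in X.
Proof.
move=> Xe uX /connectP[p ep ->]; elim: p u uX ep => [|w p IH] u uX //= /andP[ew].
by apply: IH; apply: Xe ew.
Qed.

Lemma walked_closed first x a cur v w :
  walked e first x a cur -> v \in x -> e v w -> w \in cur :: rcons x a.
Proof.
move=> wx /(nthP a)[i lt_i <-] /(walked_nbr wx lt_i)[] ->.
  by rewrite -rcons_cons mem_rcons inE mem_nth ?orbT //= ltnW.
by rewrite inE mem_nth ?orbT // size_rcons.
Qed.

(** The walk leaves and reenters [a] through distinct vertices, since a single interior vertex would
    have [a] as its only neighbour. These exhaust the neighbours of [a], so the cycle is closed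
    under adjacency. *)
Lemma walked_loop first x a v w : walked e first x a a -> #|e a| = 2 ->
  v \in a :: x -> e v w -> w \in a :: x.
Proof.
move=> wx deg_a; rewrite inE => /predU1P[->|vx] ew; last first.
  have := walked_closed wx vx ew.
  by rewrite !inE mem_rcons inE orbA orbb.
have eh := walked_head wx; have := walked_path wx.
rewrite rcons_path => /andP[_]; rewrite e_sym => el.
have ux := walked_uniq wx; have deg_x := walked_deg wx; have nbr_x := walked_nbr wx.
case: x {wx} eh el ux deg_x nbr_x => [|y [|y' x]]; first by rewrite /= e_irr.
  move=> _ _ _ deg_y nbr_y; have [q qa eq] := deg2_other a (deg_y _ (mem_head _ _)).
  by case/eqP: qa; case: (nbr_y 0 q isT eq).
move=> eh el ux _ _.
have [] := deg2_nbr deg_a eh el _ ew; last 2 first.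
- by move=> ->; rewrite inE mem_head orbT.
- by move=> -> /=; rewrite 2!in_cons mem_last !orbT.
by move: ux => /= /andP[+ _]; apply: contraNneq => ->;
  rewrite -rcons_cons mem_rcons inE mem_last orbT.
Qed.

Lemma spread_path (X : seq 'I_n) v p :
  (forall p q, p \in X -> #|e p| = 2 -> e p q -> #|e q| = 2 -> q \in X) ->
  v \in X -> path e v p -> {in v :: p, forall w, #|e w| = 2} -> {subset p <= X}.
Proof.
move=> spread; elim: p v => [|w p IH] v //= vX /andP[ew ep] deg2.
have wX : w \in X by apply: (spread v); rewrite ?deg2 ?inE ?eqxx ?orbT.
move=> u; rewrite inE => /predU1P[->//|]; apply: (IH w) => // z zp.
by apply: deg2; rewrite inE zp orbT.
Qed.

(** Started on [C], the two walks cover [C] except perhaps for [z], which is unmarked; hence the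
    successor in the bound. *)
Lemma walked_chain (C : seq 'I_n) first x1 u z x b :
  (forall u v, connect e u v) ->
  sorted e C -> {in C, forall v, #|e v| = 2} -> u \in C ->
  walked e first x1 u z -> z = u \/ #|e z| <> 2 ->
  walked e (head u x1) x z b -> b = z \/ #|e b| <> 2 ->
  #|[predC x]| <= #|[predC C]|.+1.
Proof.
move=> e_conn sC degC uC w1 stop1 w2 stop2.
suff sub : {subset C <= z :: x}.
  rewrite -add1n -(card1 z); apply: leq_trans (_ : #|[predU pred1 z & [predC C]]| <= _).
    apply/subset_leq_card/subsetP => v; rewrite !inE => vx.
    by have [//|vz] := eqVneq v z; apply: contra vx => /sub; rewrite inE (negbTE vz).
  by rewrite -cardUI leq_addr.
(* If [z] has degree two, the first walk returned to its start, and the whole graph is a cycle. *)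
have [/eqP deg_z|/eqP deg_z] := boolP (#|e z| == 2).
  case: stop1 => // Ez; rewrite -{u}Ez in uC w1 w2.
  have all1 v : v \in z :: x1.
    by apply: connect_closed (mem_head _ _) (e_conn z v) => p q; apply: walked_loop w1 deg_z.
  have deg2 v : #|e v| = 2.
    by have := all1 v; rewrite inE => /predU1P[->//|/(walked_deg w1)].
  case: stop2 => // Eb; rewrite {b}Eb in w2.
  move=> v _.
  by apply: connect_closed (mem_head _ _) (e_conn z v) => p q; apply: walked_loop w2 deg_z.
have {stop1} deg_u : #|e u| = 2 by apply: degC.
(* Otherwise [z :: x] is left only at vertices of degree other than two, so it contains [u] and
   then, in both directions, all of [C]. *)
have spread p q : p \in z :: x -> #|e p| = 2 -> e p q -> #|e q| = 2 -> q \in z :: x.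
  rewrite inE => /predU1P[->//|px] _ epq deg_q.
  have := walked_closed w2 px epq; rewrite inE mem_rcons => /predU1P[qb|//].
  by case: stop2 => [bz|]; rewrite -?qb //; rewrite qb bz mem_head.
have deg_p : {in rcons x1 u, forall v, #|e v| = 2}.
  by move=> v; rewrite mem_rcons inE => /predU1P[->//|/(walked_deg w1)].
have deg_hd : #|e (head u x1)| = 2 by apply: deg_p; rewrite headI mem_head.
have hd_x : head u x1 \in z :: x.
  have := walked_first w2; case: (x) stop2 => [|y x'] /=; last first.
    by move=> _ <-; rewrite inE mem_last orbT.
  by move=> + bE; rewrite bE => -[hz|//]; rewrite hz mem_head.
have uX : u \in z :: x.
  have := walked_path w1; rewrite headI /= => /andP[_ ep].
  have := spread_path spread hd_x ep; rewrite -headI => /(_ deg_p) sub.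
  have : u \in rcons x1 u by rewrite mem_rcons mem_head.
  by rewrite headI inE => /predU1P[->//|/sub].
case/splitPr: uC sC degC => c1 c2 /(sorted_split e_sym)[e1 e2] degC v.
rewrite mem_cat inE => /or3P[vc|/eqP->//|vc].
  apply: (spread_path spread uX e1); last by rewrite mem_rev.
  move=> w; rewrite inE mem_rev => wc; apply: degC.
  by rewrite mem_cat inE; case/orP: wc => ->; rewrite ?orbT.
by apply: (spread_path spread uX e2) => // w wc; apply: degC; rewrite mem_cat wc orbT.
Qed.

Lemma walked_chain_dec p x z b ss : walked e p x z b -> b = z \/ #|e b| <> 2 ->
  uniq ss -> (forall u, (u \in ss) = (u \notin x)) -> chain_dec e ss x b z.
Proof.
move=> wx stop uss ssE.
have ux := walked_uniq wx; rewrite rcons_uniq in ux; case/andP: ux => zx ux.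
split.
- by rewrite cat_uniq uss ux andbT; apply/hasPn => u; rewrite /= ssE negbK.
- by move=> v; rewrite mem_cat ssE orNb.
- by rewrite ssE (walked_stop e_irr wx).
- by rewrite ssE.
- exact: walked_path wx.
move=> i w lt_i; rewrite (set_nth_default z) // => /(walked_nbr wx lt_i)[->|->].
  by left; apply: set_nth_default => /=; apply: ltnW.
by right; apply: set_nth_default; rewrite size_rcons.
Qed.

End Closure.

Fixpoint tries N T f (m v : nat) : cmd :=
  if m is m'.+1 then
    trial v;; Assign 7 (Cst N.+1);; Assign 7 (Defs.Sub 7 9);;
    If 7 (decide N T f) (tries N T f m' v.+1)
  else Assign 0 (Cst 0).

(** A graph with one vertex has no arc, so the answer is positive; larger connected graphs offer
    every walk a first step. *)
Definition solver N T f : cmd :=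
  Assign 13 (Cst 1);; Assign 1 (Inp 6);; Assign 7 (Defs.Sub 1 13);;
  If 7 (tries N T f N.+1 1) (Assign 0 (Cst 1)).

Section Solver.

Variables (k N T : nat) (f : seq bool -> seq bool -> seq bool -> nat -> bool).
Hypothesis fP : forall n (e : rel 'I_n) s x a b,
    symmetric e -> chain_dec e s x a b -> size s <= N ->
    f (position_bits s a) (position_bits s b) (adjacency_bits e s) (minn (size x) T) =
    (max_cycle e <= k).
Hypothesis N_big : chain_bound k < N.

Variables (n : nat) (e : rel 'I_n) (inp : nat -> nat) (W K : nat).
Hypotheses (e_irr : irreflexive e) (e_sym : symmetric e).
Hypothesis e_conn : forall u v : 'I_n, connect e u v.
Hypothesis inpP : graph_input e inp.
Hypothesis W_big : 4 * n ^ 2 + K < W.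
Hypothesis K_big : 2 * N + T + 3 <= K.
Hypothesis n_gt1 : 1 < n.

Let K_gt0 : 0 < K. Proof. by lia. Qed.
Let lt := lt_linear W_big K_gt0.

Lemma exists_nbr u : exists w, e u w.
Proof.
have [v uv] : exists v, v != u.
  pose v0 := Ordinal (ltnW n_gt1); pose v1 := Ordinal n_gt1.
  by have [<-|] := eqVneq v0 u; [exists v1 | exists v0].
have /connectP[[|w p] /= ep Ev] := e_conn u v; first by rewrite Ev eqxx in uv.
by exists w; case/andP: ep.
Qed.

(* The trial that starts from [u] leaves at most [N] vertices unmarked. *)
Definition fruitful u := forall first x1 z x b,
  walked e first x1 u z -> z = u \/ #|e z| <> 2 ->
  walked e (head u x1) x z b -> b = z \/ #|e b| <> 2 -> #|[predC x]| <= N.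

(** Fewer than [N] vertices are outside the chain, so one of the first [N.+1] vertices is on it. *)
Lemma exists_fruitful : max_cycle e <= k -> N < n -> exists2 u : 'I_n, u <= N & fruitful u.
Proof.
move=> le_k lt_n.
have [C [sC degC cC]] := long_chain e_irr e_sym e_conn le_k (ltn_trans N_big lt_n).
have [u /andP[le_u uC]|all_N] := pickP [pred u : 'I_n | (u <= N) && (u \in C)].
  exists u => // first x1 z x b w1 s1 w2 s2.
  by apply: leq_trans (walked_chain e_irr e_sym e_conn sC degC uC w1 s1 w2 s2) _; lia.
pose g (i : 'I_N.+1) := widen_ord lt_n i.
have g_inj : injective g by move=> i j /(congr1 val) /= E; apply: val_inj.
have : #|codom g| <= #|[predC C]|.
  apply/subset_leq_card/subsetP => _ /codomP[i ->]; rewrite inE.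
  by have := all_N (g i); rewrite /= -ltnS ltn_ord /= => ->.
by rewrite card_codom // card_ord; lia.
Qed.

Definition step_bound := (3 * N + N * N + T) * (9 * n + 10) + 1 + (100 * n + 103).

(** A failed trial shows that its start is not fruitful and that more than [N] vertices exist, hence
    the disjunction. When all starts have failed, [exists_fruitful] refutes [max_cycle e <= k]. *)
Lemma runs_tries m v s : m + v = N.+2 -> 0 < v -> (N < n \/ v = 1) ->
  (forall u : 'I_n, u.+1 < v -> ~ fruitful u) ->
  reg s 1 = n -> reg s 6 = 0 -> reg s 13 = 1 -> (forall u : 'I_n, memory s u.+1 < v.*2) ->
  runs W inp (tries N T f m v) s (m * step_bound + 1)
    (fun s' => (reg s' 0 != 0) = (max_cycle e <= k)).
Proof.
elim: m v s => [|m IH] v s Emv v_gt0 nv no_u r1 r6 r13 marks.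
  have lt_n : N < n by case: nv => // v1; lia.
  apply: runs_assign => /=; [by rewrite addn1|by apply: lt; lia|rewrite /upd /=].
  apply/esym/negP => /exists_fruitful/(_ lt_n)[u le_u]; apply: no_u; lia.
rewrite /=; have lt_v : v.-1 < n by case: nv => [|->]; lia.
have [w ew] := exists_nbr (Ordinal lt_v).
apply: (@runs_seq _ _ (100 * n + 100)
  (m * step_bound + 1 + (3 * N + N * N + T) * (9 * n + 10) + 1 + 3)).
  by rewrite /step_bound mulSn; lia.
apply: (runs_trial e_irr e_sym inpP W_big K_gt0 (v0 := Ordinal lt_v) _ ew) => //.
- by rewrite /= prednK.
- by lia.
move=> s1 first x1 z x b ss w1 stop1 w2 stop2 uss ssE st_ss [R1 R6 R13] [R4 R5 R8 R9] marks1.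
have dec := walked_chain_dec e_irr w2 stop2 uss ssE.
have le_ss := max_card_uniq uss.
rewrite !addnS addn0; assign; first by apply: lt; lia.
assign; first by apply: lt; lia.
have Eif : (N.+1 - reg s1 9 != 0) = (size ss <= N) by rewrite R9 -lt0n subn_gt0 ltnS.
set s2 := set_reg _ _ _.
apply: runs_if => //=; rewrite /upd /=; last first.
  move/eqP; rewrite -[_ == 0]negbK Eif -ltnNge => lt_ss.
  apply: (@runs_weaken _ _ _ _ (m * step_bound + 1) _ _); [by lia|by move=> s'; apply: id|].
  apply: IH => //; [by lia|by left; apply: leq_trans lt_ss le_ss|].
  move=> u lt_u good_u; have [Eu|ne_u] := eqVneq u.+1 v; last by apply: (no_u u); [lia|].
  have {}Eu : u = Ordinal lt_v by apply: val_inj => /=; lia.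
  rewrite -Eu in w1 w2 stop1; have := good_u _ _ _ _ _ w1 stop1 w2 stop2.
  have -> : #|[predC x]| = #|ss| by apply: eq_card => y; rewrite inE ssE.
  by rewrite (card_uniqP uss) leqNgt lt_ss.
rewrite Eif => le_N.
apply: (@runs_weaken _ _ _ _ ((3 * N + N * N + T) * (9 * n + 10) + 1)).
- by lia.
- by move=> s'; apply: id.
apply: (runs_decide inpP W_big K_gt0 uss (a := b) (b := z) (len := size x)) => //.
- by have := max_card_uniq (walked_uniq w2); rewrite size_rcons => /ltnW.
- by lia.
- by lia.
by move=> s' ->; apply: fP.
Qed.

Lemma runs_solver : runs W inp (solver N T f) init_state (N.+1 * step_bound + 5)
  (fun s' => (reg s' 0 != 0) = (max_cycle e <= k)).
Proof.
rewrite !addnS addn0; have n0 := input_size inpP.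
assign; first by apply: lt; lia.
assign; first by rewrite n0; apply: lt; lia.
rewrite n0; assign; first by apply: lt; lia.
apply: runs_if => //=; rewrite /upd //=; last by lia.
move=> _; apply: (@runs_weaken _ _ _ _ (N.+1 * step_bound + 1)).
- by rewrite addn1.
- by move=> s'; apply: id.
- by apply: (@runs_tries N.+1 1) => //; [lia|right].
Qed.

End Solver.

Lemma max_cycle_no_arc n (e : rel 'I_n) : (forall u v, ~~ e u v) -> max_cycle e = 0.
Proof.
move=> no_e; apply/eqP; rewrite -leqn0; apply/max_cycle_leP => g s ge.
suff : xpred0 g by [].
by move: g ge; apply: arc_semigroup_ind => // a b; rewrite (negbTE (no_e a b)).
Qed.

(* The words of the machine have O(log n) bits, i.e. are bounded by w * n ^ w. *)
Theorem theorem3p10 (k : nat) :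
  exists (p : cmd) (c w : nat),
  forall (n : nat) (e : rel 'I_n) (adj : 'I_n -> seq 'I_n),
    0 < n ->
    irreflexive e -> symmetric e ->
    (forall u v : 'I_n, connect e u v) ->
    adjacency_list e adj ->
    ram_decides (w * n ^ w) (c * n) (encode adj) p (max_cycle e <= k).
Proof.
(* The successor makes room for the vertex [z] that [walked_chain] may lose. *)
pose N := (chain_bound k).+1.
have [T [f fP]] := short_cycles_table k N.
(* [K] bounds constants and marks, as the last trial uses the mark 2(N + 1) + 1; [M] bounds the
   number of questions in a lookup. *)
pose K := 2 * N + T + 3; pose M := 3 * N + N * N + T.
(* For positive [n], 9n + 10 is at most 19n, and the remaining cost 100n + 104 of a round is at most
   204n. *)
exists (solver N T f), (N.+1 * (M * 19 + 204) + 5), (K + 5).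
move=> n e adj n_gt0 e_irr e_sym e_conn /(encode_graph n_gt0) inpP.
have W_big : 4 * n ^ 2 + K < (K + 5) * n ^ (K + 5).
  apply: (@leq_trans ((K + 5) * n ^ 2)); first by nia.
  by rewrite leq_mul2l leq_pexp2l ?orbT //; lia.
have [n1|n_gt1] := leqP n 1; last first.
  have [t [s [ex le_t Es]]] :=
    runs_solver fP (leqnn _) e_irr e_sym e_conn inpP W_big (leqnn _) n_gt1.
  exists t, s; split=> //; apply: leq_trans le_t _; rewrite /step_bound -/M.
  have le_D : M * (9 * n + 10) <= M * 19 * n by rewrite -mulnA leq_mul2l; lia.
  rewrite [leqRHS]mulnDl -mulnA leq_add //; last by lia.
  by rewrite leq_mul2l [leqRHS]mulnDl; lia.
have -> : max_cycle e = 0.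
  apply: max_cycle_no_arc => u v; suff -> : u = v by rewrite e_irr.
  by apply: val_inj => /=; have := ltn_ord u; have := ltn_ord v; lia.
suff [t [s [ex le_t Es]]] : runs ((K + 5) * n ^ (K + 5)) (encode adj) (solver N T f) init_state 5
    (fun s' => (reg s' 0 != 0) = (0 <= k)).
  by exists t, s; split=> //; nia.
have lt a : a < 4 -> a < (K + 5) * n ^ (K + 5) by move=> lt_a; lia.
have n0 := input_size inpP.
assign; first by apply: lt.
assign; first by rewrite n0; apply: lt; lia.
rewrite n0; assign; first by apply: lt; lia.
apply: runs_if => //=; rewrite /upd //=; first by lia.
by move=> _; apply: runs_assign => //=; apply: lt.
Qed.
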